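(* Let $(E,\circ,\rho,\langle\cdot,\cdot\rangle)$ be a Courant algebroid over a manifold $M$ with associated structure $\mu=l_1+l_2+l_3$ on the graded vector space $V=C^\infty(M)\oplus\Gamma(E)$. Let $N:\Gamma(E)\to\Gamma(E)$ be a $(1,1)$-tensor whose Nijenhuis torsion with respect to $\circ$ vanishes and which satisfies $$N+N^*=\lambda\,\mathrm{Id}_{\Gamma(E)},\qquad N^2+(N^2)^*=\gamma\,\mathrm{Id}_{\Gamma(E)},$$ with $\lambda,\gamma$ Casimir functions. Define vector valued $1$-forms $\mathcal N,\mathcal K$ on $V$ by $$\mathcal N|_{\Gamma(E)}=N,\quad \mathcal N|_{C^\infty(M)}=\lambda\,\mathrm{Id}_{C^\infty(M)},\qquad \mathcal K|_{\Gamma(E)}=N^2=\lambda N+\tfrac{\gamma-\lambda^2}{2}\mathrm{Id}_{\Gamma(E)},\quad \mathcal K|_{C^\infty(M)}=\gamma\,\mathrm{Id}_{C^\infty(M)}.$$ Then $\mathcal N$ is a Nijenhuis vector valued $1$-form with respect to $\mu$, with square $\mathcal K$.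
   Context: Courant algebroid: a vector bundle $E\to M$ with a non-degenerate symmetric bilinear form $\langle\cdot,\cdot\rangle$, a bundle map $\rho:E\to TM$ and a bilinear operation $\circ$ on $\Gamma(E)$ such that $X\circ(Y\circ Z)=(X\circ Y)\circ Z+Y\circ(X\circ Z)$, $\rho(X)\langle Y,Z\rangle=\langle X\circ Y,Z\rangle+\langle Y,X\circ Z\rangle$, and $\rho(X)\langle Y,Z\rangle=\langle X,Y\circ Z\rangle+\langle X,Z\circ Y\rangle$. $\mathcal D:C^\infty(M)\to\Gamma(E)$ is defined by $\langle\mathcal Df,X\rangle=\rho(X)f$. A Casimir function is $f\in C^\infty(M)$ with $\rho(X)f=0$ for all $X\in\Gamma(E)$. A $(1,1)$-tensor is a $C^\infty(M)$-linear endomorphism $N$ of $\Gamma(E)$; $N^*$ is its transpose w.r.t. $\langle\cdot,\cdot\rangle$; $X\circ^NY=NX\circ Y+X\circ NY-N(X\circ Y)$; the Nijenhuis torsion is $T_\circ N(X,Y)=NX\circ NY-N(X\circ^NY)$. Associated structure (called in the paper the symmetric Lie $2$-algebra associated to the Courant algebroid): $V=C^\infty(M)\oplus\Gamma(E)$ with $C^\infty(M)$ in degree $-2$ and $\Gamma(E)$ in degree $-1$; with $[X,Y]=\frac12(X\circ Y-Y\circ X)$: $l_1f=\mathcal Df$, $l_2(X,Y)=[X,Y]$, $l_2(X,f)=l_2(f,X)=\frac12\langle X,\mathcal Df\rangle$, $l_3(X,Y,Z)=\frac16\big(\langle[X,Y],Z\rangle+\langle[Y,Z],X\rangle+\langle[Z,X],Y\rangle\big)$,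 all other components zero. On a graded vector space, a symmetric vector valued $k$-form is a graded symmetric $k$-linear map $K$ (exchanging adjacent arguments $X,Y$ gives $(-1)^{|X||Y|}$), of degree $\bar K$ if $|K(X_1,\dots,X_k)|=\sum|X_i|+\bar K$. For a $k$-form $K$ and $l$-form $L$, $$\iota_KL(X_1,\dots,X_{k+l-1})=\sum_{\sigma\in Sh(k,l-1)}\epsilon(\sigma)L(K(X_{\sigma(1)},\dots,X_{\sigma(k)}),X_{\sigma(k+1)},\dots,X_{\sigma(k+l-1)})$$ (unshuffles, Koszul sign), and $[K,L]_{_{RN}}=\iota_KL-(-1)^{\bar K\bar L}\iota_LK$, extended bilinearly. For $\mu$ of degree $1$, $\mathcal N$ of degree $0$ is Nijenhuis with respect to $\mu$ with square $\mathcal K$ if $\mathcal K$ has degree $0$, $[\mathcal N,[\mathcal N,\mu]_{_{RN}}]_{_{RN}}=[\mathcal K,\mu]_{_{RN}}$ and $[\mathcal N,\mathcal K]_{_{RN}}=0$. *)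

(* Defs.v *)
From HB Require Import structures.
From mathcomp Require Import all_boot all_order all_algebra all_fingroup.
From mathcomp Require Import all_classical all_reals all_analysis.

Set Implicit Arguments.
Unset Strict Implicit.
Unset Printing Implicit Defensive.

Import Order.TTheory GRing.Theory Num.Theory.
Import numFieldNormedType.Exports.

Local Open Scope classical_set_scope.
Local Open Scope ring_scope.

(* Meaningful for [U] open: the values of [f] outside [U] are then irrelevant. *)
Fixpoint Ck (R : realType) (n : nat) (U : set 'rV[R]_n) (k : nat)
    (f : 'rV[R]_n -> R^o) : Prop :=
  {in U, continuous f} /\
  if k is k'.+1 then
    forall j : 'I_n,
      (forall x, U x -> derivable f x (delta_mx 0 j)) /\
      Ck U k' ('D_(delta_mx 0 j) f)
  else True.

Definition Cinfty (R : realType) (n : nat) (U : set 'rV[R]_n)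
    (f : 'rV[R]_n -> R^o) : Prop := forall k, Ck U k f.

Section CinftyTheory.
Variables (R : realType) (n : nat).
Implicit Types (U : set 'rV[R]_n) (f g : 'rV[R]_n -> R^o) (k : nat).

Lemma Ck_cont U k f : Ck U k f -> {in U, continuous f}.
Proof. by case: k => [|k] []. Qed.

Lemma CkS U V k f : V `<=` U -> Ck U k f -> Ck V k f.
Proof.
move=> VU; have VUm x : x \in V -> x \in U by rewrite !inE; exact: VU.
elim: k f => [|k IH] f [cf df]; split=> //; try by move=> x /VUm; exact: cf.
move=> j; have [d1 d2] := df j; split; last exact: IH.
by move=> x /VU; exact: d1.
Qed.

Lemma CkW U k f : Ck U k.+1 f -> Ck U k f.
Proof.
elim: k f => [|k IH] f [cf df]; first by split.
by split=> // j; have [d1 d2] := df j; split=> //; exact: IH.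
Qed.

Lemma eq_Ck U k f g : open U -> (forall x, U x -> f x = g x) ->
  Ck U k f -> Ck U k g.
Proof.
move=> oU.
have nearU h1 h2 x : (forall x, U x -> h1 x = h2 x) -> U x ->
    \near x, h1 x = h2 x :> R^o.
  by move=> e Ux; apply: filterS (open_nbhs_nbhs (conj oU Ux)) => y; exact: e.
have cont h1 h2 : (forall x, U x -> h1 x = h2 x) ->
    {in U, continuous (h1 : _ -> R^o)} -> {in U, continuous (h2 : _ -> R^o)}.
  move=> e c x xU; have Ux := set_mem xU; rewrite /continuous_at -(e _ Ux).
  by apply: cvg_trans (c x xU); apply: near_eq_cvg (nearU _ _ _ e Ux).
elim: k f g => [|k IH] f g fg [cf df]; split=> //; try exact: cont fg cf.
move=> j; have [d1 d2] := df j; split=> [x Ux|].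
  exact: near_eq_derivable (nearU _ _ _ fg Ux) (d1 x Ux).
by apply: IH _ _ _ d2 => x Ux; exact: near_eq_derive (nearU _ _ _ fg Ux).
Qed.

Lemma Ck_cst U k (a : R) : Ck U k (fun=> a).
Proof.
have ca : {in U, continuous ((fun=> a) : 'rV[R]_n -> R^o)}.
  by move=> x _; exact: cst_continuous.
elim: k a ca => [|k IH] a ca; split=> // j.
split=> [x _|]; first exact: derivable_cst.
have -> : 'D_(delta_mx 0 j) (fun=> a) = (fun=> 0) :> ('rV[R]_n -> R^o).
  by apply/funext => x; exact: derive_cst.
by apply: IH => x _; exact: cst_continuous.
Qed.

Lemma CkD U k f g : open U -> Ck U k f -> Ck U k g -> Ck U k (f + g).
Proof.
move=> oU; elim: k f g => [|k IH] f g Cf Cg.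
all: have cfg : {in U, continuous (f + g)}
  by move=> x xU; exact: continuousD (Ck_cont Cf xU) (Ck_cont Cg xU).
  by split.
split=> // j; have [f1 f2] := Cf.2 j; have [g1 g2] := Cg.2 j.
split=> [x Ux|]; first by apply: derivableD; [exact: f1|exact: g1].
apply: (eq_Ck oU _ (IH _ _ f2 g2)) => x Ux.
by rewrite deriveD; [|exact: f1|exact: g1].
Qed.

Lemma CkM U k f g : open U -> Ck U k f -> Ck U k g -> Ck U k (f * g).
Proof.
move=> oU; elim: k f g => [|k IH] f g Cf Cg.
all: have cfg : {in U, continuous (f * g)}
  by move=> x xU; exact: continuousM (Ck_cont Cf xU) (Ck_cont Cg xU).
  by split.
split=> // j; have [f1 f2] := Cf.2 j; have [g1 g2] := Cg.2 j.
split=> [x Ux|]; first by apply: derivableM; [exact: f1|exact: g1].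
apply: (eq_Ck oU _ (CkD oU (IH _ _ (CkW Cf) g2) (IH _ _ (CkW Cg) f2))) => x Ux.
by rewrite deriveM; [|exact: f1|exact: g1].
Qed.

End CinftyTheory.

(* [cinv] is only constrained on [cmap @` cdom]. *)
Record chart (R : realType) (n : nat) (M : topologicalType) := Chart {
  cdom : set M;
  cmap : M -> 'rV[R]_n;
  cinv : 'rV[R]_n -> M;
  cdom_open : open cdom;
  cimg_open : open (cmap @` cdom);
  cmapK : {in cdom, cancel cmap cinv};
  cmap_cont : {in cdom, continuous cmap};
  cinv_cont : {in cmap @` cdom, continuous cinv} }.

Record manifold (R : realType) (n : nat) := Manifold {
  mpoint :> topologicalType;
  mhausdorff : hausdorff_space mpoint;
  msecond_countable : @second_countable mpoint;
  atlas : set (chart R n mpoint);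
  atlas_cover : forall x, exists2 c, atlas c & cdom c x;
  atlas_compat : forall c d, atlas c -> atlas d -> forall j : 'I_n,
    Cinfty (cmap c @` (cdom c `&` cdom d))
           (fun v => cmap d (cinv c v) 0 j) }.

Definition smooth_on (R : realType) (n : nat) (M : manifold R n) (U : set M)
    (f : M -> R^o) : Prop :=
  forall c, atlas c -> Cinfty (cmap c @` (U `&` cdom c)) (f \o cinv c).

Section SmoothTheory.
Variables (R : realType) (n : nat) (M : manifold R n).
Implicit Types (U : set M) (f g : M -> R^o).

Lemma open_cmap_image (c : chart R n M) U :
  open U -> open (cmap c @` (U `&` cdom c)).
Proof.
move=> oU; rewrite openE => _ [x [Ux cx] <-].
have ix : (cmap c @` cdom c) (cmap c x) by exists x.
have := cinv_cont (mem_set ix); rewrite /continuous_at cmapK ?inE// => cc.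
have n1 : \forall v \near cmap c x, U (cinv c v).
  exact: (cc _ (open_nbhs_nbhs (conj oU Ux))).
have n2 := open_nbhs_nbhs (conj (@cimg_open _ _ _ c) ix).
change (nbhs (cmap c x) (cmap c @` (U `&` cdom c))); 
  apply: filterS (filterI n1 n2) => v [Uv [y cy yv]].
by exists y => //; split=> //; move: Uv; rewrite -yv cmapK ?inE.
Qed.

Lemma smooth_cst U (a : R) : smooth_on U (fun=> a).
Proof. by move=> c _ k; exact: Ck_cst. Qed.

Lemma smoothD U f g : open U ->
  smooth_on U f -> smooth_on U g -> smooth_on U (f + g).
Proof.
by move=> oU sf sg c ac k; apply: CkD (sf c ac k) (sg c ac k);
  exact: open_cmap_image.
Qed.

Lemma smoothM U f g : open U ->
  smooth_on U f -> smooth_on U g -> smooth_on U (f * g).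
Proof.
by move=> oU sf sg c ac k; apply: CkM (sf c ac k) (sg c ac k);
  exact: open_cmap_image.
Qed.

End SmoothTheory.

Section SmoothFunctions.
Variables (R : realType) (n : nat) (M : manifold R n).

Definition cinf_pred : {pred M -> R^o} := mem [set f | smooth_on setT f].

Record cinf := Cinf { cinf_fun :> M -> R^o; _ : cinf_fun \in cinf_pred }.

HB.instance Definition _ := [isSub for cinf_fun].
HB.instance Definition _ := [Choice of cinf by <:].

Lemma cinfP (f : cinf) : smooth_on setT f.
Proof. by case: f => f /=; rewrite inE. Qed.

Lemma cinf_subring : subring_closed cinf_pred.
Proof.
have sM f g : f \in cinf_pred -> g \in cinf_pred -> f * g \in cinf_pred.
  by rewrite !inE => sf sg; exact: (smoothM openT sf sg).
split=> //; first by rewrite inE; exact: smooth_cst.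
move=> f g; rewrite !inE => sf sg; rewrite -mulN1r.
exact: (smoothD openT sf (smoothM openT (smooth_cst setT (-1)) sg)).
Qed.

HB.instance Definition _ :=
  GRing.isSubringClosed.Build _ cinf_pred cinf_subring.
HB.instance Definition _ := 
  GRing.SubChoice_isSubComPzRing.Build _ _ cinf (subringClosedP cinf_pred).

Lemma cinf_scale : GRing.scaler_closed cinf_pred.
Proof.
move=> a f; rewrite !inE => sf.
exact: (smoothM openT (smooth_cst setT a) sf).
Qed.

HB.instance Definition _ := GRing.isScaleClosed.Build _ _ cinf_pred cinf_scale.
HB.instance Definition _ := [SubZmodule_isSubLmodule of cinf by <:].

Definition mk_cinf (f : M -> R^o) (sf : smooth_on setT f) : cinf :=
  Cinf (mem_set sf).

End SmoothFunctions.

(* A bundle is given by its fibres and a bundle atlas; [triv] and [triv_inv]  *)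
(* are unconstrained outside [tdom].                                          *)
Record local_triv (R : realType) (n r : nat) (M : manifold R n)
    (F : M -> lmodType R) := LocalTriv {
  tdom : set M;
  triv : forall x, F x -> 'rV[R]_r;
  triv_inv : forall x, 'rV[R]_r -> F x;
  tdom_open : open tdom;
  triv_linear : forall x, tdom x -> linear (@triv x);
  trivK : forall x, tdom x -> cancel (@triv x) (@triv_inv x);
  triv_invK : forall x, tdom x -> cancel (@triv_inv x) (@triv x) }.

Record vbundle (R : realType) (n r : nat) (M : manifold R n) := VBundle {
  fib : M -> lmodType R;
  batlas : set (local_triv r fib);
  batlas_cover : forall x, exists2 a, batlas a & tdom a x;
  batlas_compat : forall a b, batlas a -> batlas b -> forall i j : 'I_r,
    smooth_on (tdom a `&` tdom b)
      (fun x => triv b (triv_inv a x (delta_mx 0 i)) 0 j) }.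

Section Sections.
Variables (R : realType) (n r : nat) (M : manifold R n) (E : vbundle r M).

Definition smooth_section (s : forall x, fib E x) : Prop :=
  forall a, batlas a -> forall j : 'I_r,
    smooth_on (tdom a) (fun x => triv a (s x) 0 j).

Record sect := Sect {
  sect_fun :> forall x, fib E x;
  sectP : smooth_section sect_fun }.

HB.instance Definition _ := gen_eqMixin sect.
HB.instance Definition _ := gen_choiceMixin sect.

Lemma sect_eq (s t : sect) : (forall x, s x = t x) -> s = t.
Proof.
case: s t => [s sP] [t tP] /= st.
have e : s = t by exact: functional_extensionality_dep.
by rewrite -e in tP *; congr Sect; exact: Prop_irrelevance.
Qed.

Lemma smooth_section_comb (f : cinf M) (s t : sect) :
  smooth_section (fun x => f x *: s x + t x).
Proof.
move=> a aE j c cM k.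
have oc := @open_cmap_image _ _ _ c _ (@tdom_open _ _ _ _ _ a).
have fc : Ck (cmap c @` (tdom a `&` cdom c)) k (f \o cinv c).
  by apply: CkS (cinfP f cM k) => _ [x [_ cx] <-]; exists x.
have h := CkD oc (CkM oc fc (sectP s aE j cM k)) (sectP t aE j cM k).
apply: (eq_Ck oc _ h) => _ [x [ax cx] <-]; rewrite !fctE.
by rewrite (cmapK (mem_set cx)) triv_linear// !mxE.
Qed.

Definition sect_comb (f : cinf M) (s t : sect) : sect :=
  Sect (smooth_section_comb f s t).

Lemma smooth_section0 : smooth_section (fun x => 0).
Proof.
move=> a aE j c cM k.
have oc := @open_cmap_image _ _ _ c _ (@tdom_open _ _ _ _ _ a).
apply: (eq_Ck oc _ (Ck_cst _ k 0)) => _ [x [ax cx] <-] /=.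
rewrite (cmapK (mem_set cx)).
have := triv_linear ax (-1) 0 0; rewrite !scaleN1r oppr0 addr0 addNr => ->.
by rewrite mxE.
Qed.

Definition sect0 : sect := Sect smooth_section0.
Definition sectD (s t : sect) : sect := sect_comb 1 s t.
Definition sectN (s : sect) : sect := sect_comb (- (1 : cinf M)) s sect0.
Definition sectZ (a : R) (s : sect) : sect := sect_comb (a *: (1 : cinf M)) s sect0.
Definition fscale (f : cinf M) (s : sect) : sect := sect_comb f s sect0.

Lemma sectDE s t x : sectD s t x = s x + t x.
Proof. by rewrite /= scale1r. Qed.
Lemma sectNE s x : sectN s x = - s x.
Proof. by rewrite /= scaleN1r addr0. Qed.
Lemma sectZE a s x : sectZ a s x = a *: s x.
Proof. by rewrite -[RHS]addr0; congr (_ *: _ + _); exact: mulr1. Qed.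

Lemma sectDA : associative sectD.
Proof. by move=> s t u; apply: sect_eq => x; rewrite !sectDE addrA. Qed.
Lemma sectDC : commutative sectD.
Proof. by move=> s t; apply: sect_eq => x; rewrite !sectDE addrC. Qed.
Lemma sect0D : left_id sect0 sectD.
Proof. by move=> s; apply: sect_eq => x; rewrite !sectDE add0r. Qed.
Lemma sectND : left_inverse sect0 sectN sectD.
Proof. by move=> s; apply: sect_eq => x; rewrite sectDE sectNE addNr. Qed.

HB.instance Definition _ :=
  GRing.isZmodule.Build sect sectDA sectDC sect0D sectND.

Lemma sectZA a b s : sectZ a (sectZ b s) = sectZ (a * b) s.
Proof. by apply: sect_eq => x; rewrite !sectZE scalerA. Qed.
Lemma sect1Z : left_id 1 sectZ.
Proof. by move=> s; apply: sect_eq => x; rewrite sectZE scale1r. Qed.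
Lemma sectZDr : right_distributive sectZ +%R.
Proof.
by move=> a s t; apply: sect_eq => x; rewrite !(sectZE, sectDE) scalerDr.
Qed.
Lemma sectZDl s : {morph sectZ^~ s : a b / a + b}.
Proof.
by move=> a b; apply: sect_eq => x; rewrite !(sectZE, sectDE) scalerDl.
Qed.

HB.instance Definition _ :=
  GRing.Zmodule_isLmodule.Build R sect sectZA sect1Z sectZDr sectZDl.

End Sections.

Section Courant.
Variables (R : realType) (n r : nat) (M : manifold R n) (E : vbundle r M).

(* A fibrewise form on [E] is smooth iff its value on any two smooth sections *)
(* is; a fibrewise map [E -> TM] is smooth iff it sends smooth sections to    *)
(* smooth vector fields, i.e. those preserving smooth functions.              *)
Record metric := Metric {
  form : forall x, fib E x -> fib E x -> R;
  form_linear : forall x a (u v w : fib E x),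
    form (a *: u + v) w = a * form u w + form v w;
  form_sym : forall x (u v : fib E x), form u v = form v u;
  form_nondeg : forall x (u : fib E x), (forall v, form u v = 0) -> u = 0;
  form_smooth : forall X Y : sect E, smooth_on setT (fun x => form (X x) (Y x)) }.

(* [T_x M] is the space of derivations at [x] of the algebra of smooth        *)
(* functions.                                                                 *)
Definition tangent_vector (x : M) (v : cinf M -> R) : Prop :=
  (forall a f g, v (a *: f + g) = a * v f + v g) /\
  (forall f g, v (f * g) = v f * g x + f x * v g).

Record anchor := Anchor {
  anch : forall x, fib E x -> cinf M -> R;
  anch_tangent : forall x (u : fib E x), tangent_vector x (anch u);
  anch_linear : forall x a (u v : fib E x) f,
    anch (a *: u + v) f = a * anch u f + anch v f;
  anch_smooth : forall (X : sect E) f, smooth_on setT (fun x => anch (X x) f) }.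

Definition pairing (g : metric) (X Y : sect E) : cinf M :=
  mk_cinf (form_smooth g X Y).

Definition vf (rho : anchor) (X : sect E) (f : cinf M) : cinf M :=
  mk_cinf (anch_smooth rho X f).

Record courant := Courant {
  cmetric : metric;
  canchor : anchor;
  dorf : sect E -> sect E -> sect E;
  dorf_linearl : forall a X Y Z,
    dorf (a *: X + Y) Z = a *: dorf X Z + dorf Y Z;
  dorf_linearr : forall a X Y Z,
    dorf X (a *: Y + Z) = a *: dorf X Y + dorf X Z;
  dorf_jacobi : forall X Y Z,
    dorf X (dorf Y Z) = dorf (dorf X Y) Z + dorf Y (dorf X Z);
  dorf_metric : forall X Y Z,
    vf canchor X (pairing cmetric Y Z) =
    pairing cmetric (dorf X Y) Z + pairing cmetric Y (dorf X Z);
  dorf_sym : forall X Y Z,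
    vf canchor X (pairing cmetric Y Z) =
    pairing cmetric X (dorf Y Z) + pairing cmetric X (dorf Z Y) }.

Variable C : courant.
Local Notation "<| X , Y |>" := (pairing (cmetric C) X Y).

(* The pairing is non-degenerate, so exactly one section qualifies; the       *)
(* default value 0 is never used.                                             *)
Definition courantD (f : cinf M) : sect E :=
  xget 0 [set s | forall X, <| s, X |> = vf (canchor C) X f].

Definition casimir (f : cinf M) : Prop := forall X, vf (canchor C) X f = 0.

Definition tensor11 (N : sect E -> sect E) : Prop :=
  forall f X Y, N (fscale f X + Y) = fscale f (N X) + N Y.

Definition transpose (N Ns : sect E -> sect E) : Prop :=
  forall X Y, <| N X, Y |> = <| X, Ns Y |>.

Definition dorf_def (N : sect E -> sect E) (X Y : sect E) : sect E :=
  dorf C (N X) Y + dorf C X (N Y) - N (dorf C X Y).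

Definition torsion (N : sect E -> sect E) (X Y : sect E) : sect E :=
  dorf C (N X) (N Y) - N (dorf_def N X Y).

Definition skew_bracket (X Y : sect E) : sect E :=
  2%:R^-1 *: (dorf C X Y - dorf C Y X).

End Courant.

Record gvect (R : realType) := GVect {
  gcar :> lmodType R;
  homog : int -> set gcar;
  homog0 : forall d, homog d 0;
  homog_linear : forall d a u v,
    homog d u -> homog d v -> homog d (a *: u + v);
  homog_span : forall v, exists (s : seq int) (c : int -> gcar),
    (forall d, homog d (c d)) /\ v = \sum_(d <- s) c d;
  homog_free : forall (s : seq int) (c : int -> gcar), uniq s ->
    (forall d, homog d (c d)) -> \sum_(d <- s) c d = 0 ->
    forall d, d \in s -> c d = 0 }.

Section Forms.
Variables (R : realType) (V : gvect R).

(* A finite sum of forms of various arities is a function on lists: its       *)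
(* [k]-form component is the restriction to lists of length [k].              *)
Implicit Types (K L : seq V -> V) (x : seq V).

Definition multilinear K : Prop := forall s t a u v,
  K (s ++ (a *: u + v) :: t) = a *: K (s ++ u :: t) + K (s ++ v :: t).

Definition graded_symmetric K : Prop := forall s t p q u v,
  homog p u -> homog q v ->
  K (s ++ u :: v :: t) = ((-1) ^ (p * q)) *: K (s ++ v :: u :: t).

Definition has_degree (e : int) K : Prop :=
  forall y : seq (int * V), (forall p, p \in y -> homog p.1 p.2) ->
    homog (\sum_(p <- y) p.1 + e) (K (map snd y)).

Definition sym_form (e : int) K : Prop :=
  [/\ multilinear K, graded_symmetric K & has_degree e K].

Definition is_kform (k : nat) K : Prop := forall x, size x != k -> K x = 0.

(* The degree of a nonzero homogeneous vector. Its value at 0 is unspecified, *)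
(* which is harmless: it only occurs in signs in front of multilinear         *)
(* expressions in the vector.                                                 *)
Definition gdeg (v : V) : int := xget 0 [set d | homog d v].

Definition unshuffle (m k : nat) (s : 'S_m) : bool :=
  [forall i : 'I_m, forall j : 'I_m,
     ((i < j < k) || (k <= i < j))%N ==> (s i < s j)%N].

Definition koszul x (s : 'S_(size x)) : R :=
  \prod_(i < size x) \prod_(j < size x | (i < j)%N && (s j < s i)%N)
    (-1) ^ (gdeg x`_(s i) * gdeg x`_(s j)).

Definition permuted x (s : 'S_(size x)) : seq V :=
  [seq x`_(s i) | i <- enum 'I_(size x)].

(* On a list of length [m], the summand [k] inserts the [k]-form component of *)
(* [K] into the [(m - k + 1)]-form component of [L].                          *)
Definition insertion K L x : V :=
  \sum_(k < (size x).+1) \sum_(s : 'S_(size x) | unshuffle k s)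
    koszul s *: L (K (take k (permuted s)) :: drop k (permuted s)).

Definition RN (dK dL : int) K L x : V :=
  insertion K L x - ((-1) ^ (dK * dL)) *: insertion L K x.

(* Because of the Koszul signs, [insertion] and [RN] are only meaningful on   *)
(* homogeneous arguments, which determine a multilinear map.                  *)
Definition eq_form K L : Prop :=
  forall x, (forall i, (i < size x)%N -> exists d, homog d x`_i) -> K x = L x.

Definition nijenhuis (mu N K : seq V -> V) : Prop :=
  [/\ sym_form 1 mu, sym_form 0 N, sym_form 0 K,
      eq_form (RN 0 1 N (RN 0 1 N mu)) (RN 0 1 K mu) &
      eq_form (RN 0 0 N K) (fun=> 0)].

End Forms.

(* Functions, the first component, have degree -2 and sections degree -1.     *)
Section CourantLie2.
Variables (R : realType) (n r : nat) (M : manifold R n) (E : vbundle r M).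

Definition cE_homog (d : int) : set (cinf M * sect E)%type :=
  [set v | (d != - 2 -> v.1 = 0) /\ (d != - 1 -> v.2 = 0)].

Lemma cE_homog0 d : cE_homog d 0.
Proof. by []. Qed.

Lemma cE_homog_linear d a u v :
  cE_homog d u -> cE_homog d v -> cE_homog d (a *: u + v).
Proof.
move=> [u1 u2] [v1 v2]; split=> dd /=.
  by rewrite u1// v1// scaler0 addr0.
by rewrite u2// v2// scaler0 addr0.
Qed.

Lemma cE_homog_span v : exists (s : seq int) (c : int -> (cinf M * sect E)%type),
  (forall d, cE_homog d (c d)) /\ v = \sum_(d <- s) c d.
Proof.
exists [:: - 2; - 1].
exists (fun d => (if d == - 2 then v.1 else 0, if d == - 1 then v.2 else 0)).
split=> [d|]; first by split=> /= /negbTE ->.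
rewrite big_cons big_seq1 /= [RHS]surjective_pairing /= addr0 add0r.
exact: surjective_pairing.
Qed.

Lemma cE_homog_free (s : seq int) (c : int -> (cinf M * sect E)%type) :
  uniq s -> (forall d, cE_homog d (c d)) -> \sum_(d <- s) c d = 0 ->
  forall d, d \in s -> c d = 0.
Proof.
move=> us hc s0 d ds.
have e1 : \sum_(d <- s) (c d).1 = 0.
  by have := congr1 fst s0; rewrite raddf_sum.
have e2 : \sum_(d <- s) (c d).2 = 0.
  by have := congr1 snd s0; rewrite raddf_sum.
have [h1 h2] := hc d.
rewrite [c d]surjective_pairing; congr pair.
  have [dd|/h1//] := eqVneq d (- 2).
  move: e1; rewrite (bigD1_seq d)//= big1 ?addr0// => d' nd.
  by apply: (hc d').1; rewrite -dd.
have [dd|/h2//] := eqVneq d (- 1).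
move: e2; rewrite (bigD1_seq d)//= big1 ?addr0// => d' nd.
by apply: (hc d').2; rewrite -dd.
Qed.

Definition cE_gvect : gvect R :=
  GVect cE_homog0 cE_homog_linear cE_homog_span cE_homog_free.

Definition one_form (N : sect E -> sect E) (lam : cinf M)
    (x : seq cE_gvect) : cE_gvect :=
  if x is [:: v] then (lam * v.1, N v.2) else 0.

Variable C : courant E.
Local Notation "<| X , Y |>" := (pairing (cmetric C) X Y).
Local Notation D := (courantD C).
Local Notation br := (skew_bracket C).

Definition l1 (x : seq cE_gvect) : cE_gvect :=
  if x is [:: u] then (0, D u.1) else 0.

Definition l2 (x : seq cE_gvect) : cE_gvect :=
  if x is [:: u; v] then
    (2%:R^-1 *: (<| u.2, D v.1 |> + <| v.2, D u.1 |>), br u.2 v.2)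
  else 0.

Definition l3 (x : seq cE_gvect) : cE_gvect :=
  if x is [:: u; v; w] then
    (6%:R^-1 *: (<| br u.2 v.2, w.2 |> + <| br v.2 w.2, u.2 |>
                 + <| br w.2 u.2, v.2 |>), 0)
  else 0.

Definition courant_mu (x : seq cE_gvect) : cE_gvect := l1 x + l2 x + l3 x.

End CourantLie2.

(* Main.v *)
Require Import Defs.
From HB Require Import structures.
From mathcomp Require Import all_boot all_order all_algebra all_fingroup.
From mathcomp Require Import all_classical all_reals all_analysis.
From mathcomp Require Import ring zify.

Set Implicit Arguments.
Unset Strict Implicit.
Unset Printing Implicit Defensive.

Import Order.TTheory GRing.Theory Num.Theory.
Import numFieldNormedType.Exports.

Local Open Scope classical_set_scope.
Local Open Scope ring_scope.

(** Put [mu = l1 + l2 + l3].  Graded symmetry of a form [L] reduces the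
    Richardson-Nijenhuis bracket with a 1-form [T] of degree 0 to the derivation
      [ [T, L](x_1, .., x_k) = sum_i L(.., T x_i, ..) - T(L(x_1, .., x_k)) ]
    ([RN_1form]); the unshuffles that survive merely bring one argument to the
    front, and the Koszul sign is the one that puts it back.

    For [T] equal to [N] on sections and to [lam] on functions, this derivation
    sends the components (unary, mixed, binary, ternary) of a form of the same
    shape as [mu] to components of the same shape ([deform], [ad_brackets]).  So
    both sides of the Nijenhuis identity can be compared component by component
    ([deform_courant_twice]).  Write the two hypotheses on [N] as
    [<NX, Y> + <X, NY> = lam <X, Y>] and
    [<N^2 X, Y> + <X, N^2 Y> = gam <X, Y>], and recall that a Casimir function
    [c] satisfies [D(c f) = c D f].
    - Unary part: [D] is sent to [lam D - N D = N' D], with [N'] the transpose of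
      [N], hence twice to [N' N' D = gam D - N^2 D].
    - Mixed part: [<X, D f>] is sent to [<N X, D f>], hence twice to
      [<N^2 X, D f>].
    - Binary part: the difference of the two sides is twice the torsion of [N]
      for the skew bracket, which is the skew part of the torsion for the Dorfman
      bracket ([skew_torsion0]).
    - Ternary part: a cyclic sum of [<b(X, Y), Z>] is sent to the same sum for
      the deformed [b], since [<b, N Z> - lam <b, Z> = - <N b, Z>]
      ([deform_cyclic_pairing]); the binary part then settles it.

    All of this needs [D f] to be an actual smooth section depending linearly on
    [f], and sections to be determined by their pairings.  Both rest on a
    smooth bump function, which extends every vector of a fibre to a global
    section ([section_through]).  Existence of [D f] is then read off the
    Courant axioms: [D <Y, Z> = Y o Z + Z o Y] is a section, and the Leibniz rule
    gives [<Y, Z> D f = D <f Y, Z> - f D <Y, Z>], which defines [D f] smoothly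
    wherever [<Y, Z>] does not vanish ([gradient_exists]). *)

(** * A flat smooth function of one variable *)

Section ChainRule.
Variables (R : realType) (V : normedModType R).

(** The directional derivative only sees the curve [h |-> g (h *: v + x)],
    which reduces the claim to the one-variable chain rule. *)
Lemma is_derive_comp1 (phi : R -> R^o) (g : V -> R^o) x v (dphi dg : R^o) :
  is_derive x v g dg -> is_derive (g x) 1 phi dphi ->
  is_derive x v (phi \o g) (dphi * dg).
Proof.
move=> [dgx <-] [dpx <-].
have curve (f : V -> R^o) : 'D_v f x = ((fun h : R => f (h *: v + x))^`() 0)%classic.
  rewrite /derive /derive1; set d := (fun _ : R => _); set d' := (fun _ : R => _).
  suff -> : d = d' by [].
  by apply/funext => h; rewrite /d /d' /= addr0 scale0r add0r.
have := (derivable1P g x v).1 dgx; set c := (fun h : R => _) => dc.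
have c0 : c 0 = g x by rewrite /c scale0r add0r.
rewrite -c0 in dpx.
have dpc : derivable (phi \o c) 0 1.
  apply/derivable1_diffP; apply: differentiable_comp; apply/derivable1_diffP.
    exact: dc.
  exact: dpx.
apply: DeriveDef; first exact: (derivable1P (phi \o g) x v).2.
by rewrite !curve (derive1_comp dc dpx) derive1E c0.
Qed.

End ChainRule.

Section FlatFunctions.
Variable R : realType.

(** The functions [t^-j exp(-1/t)] extended by 0: up to linear combinations this
    family is stable under derivation, which makes the iterated derivatives of
    [exp(-1/t)] accessible by induction. *)
Definition flat (j : nat) (t : R) : R :=
  if 0 < t then t^-1 ^+ j * expR (- t^-1) else 0.

Lemma flat_gt0 j t : 0 < t -> 0 < flat j t.
Proof.
by move=> t0; rewrite /flat t0 mulr_gt0 ?expR_gt0// exprn_gt0// invr_gt0.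
Qed.

Lemma flat_eq0 j t : t <= 0 -> flat j t = 0.
Proof. by rewrite /flat leNgt => /negbTE ->. Qed.

(** One term of the exponential series at [1/t] beats any negative power of [t];
    the quadratic bound is what kills the difference quotient at 0. *)
Lemma flat_bound j t : `|flat j t| <= j.+2`!%:R * t ^+ 2.
Proof.
have [t0|t0] := leP t 0.
  by rewrite flat_eq0// normr0 mulr_ge0 ?sqr_ge0.
rewrite gtr0_norm ?flat_gt0// /flat t0 expRN.
have u0 : 0 < t^-1 by rewrite invr_gt0.
rewrite ler_pdivrMr ?expR_gt0//.
have h := expR_ge1Dxn j.+1 (ltW u0).
have {}h : t^-1 ^+ j.+2 / j.+2`!%:R <= expR t^-1.
  by apply: le_trans h; rewrite lerDr.
have c0 : 0 < j.+2`!%:R :> R by rewrite ltr0n fact_gt0.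
rewrite ler_pdivrMr// in h.
have t2 : 0 <= t ^+ 2 by exact: sqr_ge0.
apply: le_trans (_ : t ^+ 2 * t^-1 ^+ j.+2 <= _); last first.
  by rewrite (mulrC j.+2`!%:R) -[leRHS]mulrA ler_wpM2l// mulrC.
by rewrite -(addn2 j) addnC exprD mulrA -exprMn divff ?gt_eqF// expr1n mul1r.
Qed.

Lemma is_derive_flat (j : nat) (t : R) :
  is_derive t 1 (flat j : R -> R^o) (- j%:R * flat j.+1 t + flat j.+2 t).
Proof.
have [t0|t0|->] := ltgtP t 0.
- rewrite !flat_eq0 ?ltW// mulr0 addr0.
  apply: (@near_eq_is_derive _ _ _ (cst (0 : R^o))).
  by near=> s; rewrite /= flat_eq0// ltW//; near: s; exact: lt_nbhsl.
- pose F (s : R) : R^o := s^-1 ^+ j * expR (- s^-1).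
  apply: (@near_eq_is_derive _ _ _ F).
    by near=> s; rewrite /F /flat; have -> : 0 < s by near: s; exact: lt_nbhsr.
  have dinv : is_derive t 1 (fun s : R => s^-1 : R^o) (- t ^- 2).
    apply: is_derive_eq (is_deriveV _ _) _; first by rewrite gt_eqF.
    by rewrite /GRing.scale/= mulr1.
  pose phi (u : R) : R^o := u ^+ j * expR (- u).
  have dphi (u : R) : is_derive u 1 phi
      (j%:R * u ^+ j.-1 * expR (- u) - u ^+ j * expR (- u)).
    have h1 := @is_deriveX R R^o id j u 1 _ (is_derive_id u 1).
    have h2 := is_derive_comp1
      (@is_deriveN R R^o R^o id u 1 _ (is_derive_id u 1)) (is_derive_expR (- u)).
    have -> : phi = (id : R -> R^o) ^+ j * (expR \o - (id : R^o -> R^o)).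
      apply/funext => w; rewrite /phi.
      by rewrite -[RHS]/(((id : R -> R^o) ^+ j) w * expR (- w)) exprfctE.
    apply: is_derive_eq (is_deriveM h1 h2) _.
    rewrite /GRing.scale/= exprfctE/= !mulr1 !mulrN mulr1 addrC; congr (_ - _).
    by rewrite mulrC.
  apply: is_derive_eq (is_derive_comp1 dinv (dphi _)) _.
  rewrite /flat t0.
  case: (j) => [|i] /=; rewrite ?exprS; field; exact: lt0r_neq0.
- rewrite !flat_eq0// mulr0 addr0.
  have lim0 :
      (fun h : R => h^-1 *: ((flat j \o shift 0) (h *: 1) - flat j 0) : R^o) @ 0^'
      --> (0 : R^o).
    have lim1 : (fun h : R => j.+2`!%:R * `|h| : R^o) @ 0^' --> (0 : R^o).
      rewrite -[X in _ --> X](mulr0 j.+2`!%:R) -{2}(@normr0 _ R).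
      apply: cvgM; first exact: cvg_cst.
      by apply: cvg_norm; exact: nbhs_dnbhs.
    apply/norm_cvg0P.
    apply: (squeeze_cvgr _ (cvg_cst 0) lim1); near=> h.
    rewrite normr_ge0/= addr0 (flat_eq0 j (lexx 0)) subr0 [X in flat j X]mulr1.
    have h0 : h != 0 by near: h; exact: nbhs_dnbhs_neq.
    rewrite [_ *: _]/GRing.scale/= normrM normfV ler_pdivrMl ?normr_gt0//.
    apply: le_trans (flat_bound _ _) _.
    by rewrite [leRHS]mulrCA -[X in _ <= _ * X]expr2 real_normK ?num_real.
  apply: DeriveDef; first by apply/cvg_ex; exists 0.
  exact: cvg_lim lim0.
Unshelve. all: by end_near. Qed.

End FlatFunctions.

(** * Local properties and closure properties of smooth functions *)

Section CkExtra.
Variables (R : realType) (n : nat).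
Implicit Types (U V : set 'rV[R]_n) (f g : 'rV[R]_n -> R^o) (k : nat).

(** The derivatives in [Ck] are those of the function on the whole space, so that
    [Ck V k f] is a condition on each point of [V] separately;
    [V] may be any set containing it. *)
Lemma Ck_pointwise U k f :
  (forall x, U x -> exists2 V, V x & Ck V k f) -> Ck U k f.
Proof.
elim: k f => [|k IH] f loc.
  by split=> // x /set_mem /loc[V Vx [cf _]]; apply: cf; rewrite inE.
split=> [x /set_mem /loc[V Vx [cf _]]|j]; first by apply: cf; rewrite inE.
split=> [x /loc[V Vx [_ /(_ j)[df _]]]|]; first exact: df.
by apply: IH => x /loc[V Vx [_ /(_ j)[_ df]]]; exists V.
Qed.

(** The induction on [k] has to run over all [j] at once, because differentiating
    [flat j] brings in [flat j.+1] and [flat j.+2]. *)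
Lemma Ck_flat U k j g : open U -> Ck U k g ->
  Ck U k (fun x => flat j (g x) : R^o).
Proof.
move=> oU; have cflat i : continuous (flat i : R -> R^o).
  move=> t; apply: differentiable_continuous.
  by apply/derivable1_diffP; have [] := is_derive_flat i t.
elim: k j g => [|k IH] j g Cg.
all: have cfg : {in U, continuous (fun x => flat j (g x) : R^o)}
  by move=> x xU; apply: continuous_comp (Ck_cont Cg xU) _; exact: cflat.
  by split.
split=> // i; have [d1 d2] := Cg.2 i.
have D x : U x -> is_derive x (delta_mx 0 i) (fun x => flat j (g x) : R^o)
    ((- j%:R * flat j.+1 (g x) + flat j.+2 (g x)) * 'D_(delta_mx 0 i) g x).
  move=> Ux; apply: is_derive_comp1 (is_derive_flat j (g x)).
  exact/derivableP/d1.
split=> [x /D[]//|].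
have CM := CkM oU (CkD oU (CkM oU (Ck_cst U k (- j%:R)) (IH j.+1 _ (CkW Cg)))
  (IH j.+2 _ (CkW Cg))) d2.
by apply: (eq_Ck oU _ CM) => x /D[_ ->].
Qed.

Lemma Ck_inv U k g : open U -> (forall x, U x -> g x != 0) -> Ck U k g ->
  Ck U k (fun x => (g x)^-1 : R^o).
Proof.
move=> oU gU; elim: k => [|k IH] Cg.
all: have cfg : {in U, continuous (fun x => (g x)^-1 : R^o)}
  by move=> x xU; apply: continuousV (Ck_cont Cg xU); rewrite ?gU// -in_setE.
  by split.
split=> // i; have [d1 d2] := Cg.2 i.
split=> [x Ux|]; first by apply: derivableV; [exact: gU|exact: d1].
have Ci := IH (CkW Cg).
have CM := CkM oU (CkM oU (Ck_cst U k (-1)) (CkM oU Ci Ci)) d2.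
apply: (eq_Ck oU _ CM) => x Ux.
rewrite deriveV ?gU//; last exact: d1.
by rewrite !fctE [RHS]/GRing.scale/= mulN1r expr2 invfM.
Qed.

End CkExtra.

Section SmoothLocal.
Variables (R : realType) (n : nat) (M : manifold R n).
Implicit Types (U V : set M) (f g : M -> R^o).

Lemma smooth_onS U V f : V `<=` U -> smooth_on U f -> smooth_on V f.
Proof.
move=> VU sf c ac k; apply: CkS (sf c ac k) => _ [x [Vx cx] <-].
by exists x => //; split=> //; exact: VU.
Qed.

Lemma smooth_on_local U f :
  (forall x, U x -> exists2 V, V x & smooth_on V f) -> smooth_on U f.
Proof.
move=> loc c ac k; apply: Ck_pointwise => _ [x [Ux cx] <-].
have [V Vx sf] := loc x Ux; exists (cmap c @` (V `&` cdom c)); last exact: sf.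
by exists x.
Qed.

Lemma eq_smooth_on U f g : open U -> (forall x, U x -> f x = g x) ->
  smooth_on U f -> smooth_on U g.
Proof.
move=> oU fg sf c ac k.
apply: (eq_Ck (open_cmap_image oU) _ (sf c ac k)) => _ [x [Ux cx] <-] /=.
by rewrite (cmapK (mem_set cx)) fg.
Qed.

Lemma smooth_on_inv U f : open U -> (forall x, U x -> f x != 0) ->
  smooth_on U f -> smooth_on U (fun x => (f x)^-1 : R^o).
Proof.
move=> oU f0 sf c ac k.
apply: (Ck_inv (open_cmap_image oU) _ (sf c ac k)) => _ [x [Ux cx] <-] /=.
by rewrite (cmapK (mem_set cx)) f0.
Qed.

Lemma smooth_on_sum U (I : Type) (r : seq I) (F : I -> M -> R^o) : open U ->
  (forall i, smooth_on U (F i)) -> smooth_on U (\sum_(i <- r) F i).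
Proof.
move=> oU sF; elim/big_ind : _ => //; first exact: smooth_cst.
by move=> f g sf sg; exact: smoothD.
Qed.

Lemma smooth_on_continuous U f : open U -> smooth_on U f ->
  {in U, continuous f}.
Proof.
move=> oU sf x /set_mem Ux.
have [c ac cx] := atlas_cover x.
have xU : cmap c x \in cmap c @` (U `&` cdom c) by rewrite inE; exists x.
have := Ck_cont (sf c ac 0%N) xU; rewrite /continuous_at /= cmapK ?inE// => cf.
have cc := cmap_cont (mem_set cx).
have h : f \o cinv c \o cmap c @ x --> f x by apply: cvg_comp cc cf.
apply: cvg_trans h; apply: near_eq_cvg.
have : nbhs x (cdom c) by apply: open_nbhs_nbhs; split=> //; exact: cdom_open.
by apply: filterS => y cy /=; rewrite cmapK ?inE.
Qed.

End SmoothLocal.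

(** * Bump functions *)

Section Bump.
Variables (R : realType) (n : nat) (M : manifold R n).

Lemma closed_box_sub (U : set 'rV[R]_n) p : open U -> U p ->
  exists2 e : R, 0 < e &
    [set v : 'rV[R]_n | forall j, `[p 0 j - e, p 0 j + e]%classic (v 0 j)] `<=` U.
Proof.
move=> oU Up.
have /nbhs_ballP[e /= e0 eU] : nbhs p U by apply: open_nbhs_nbhs.
exists (e / 2); first by rewrite divr_gt0.
move=> v vbox; apply: eU; split=> // i j; rewrite ord1.
have := vbox j; rewrite /= in_itv/= => /andP[h1 h2].
rewrite /ball/= ltr_distlC.
have e2 : e / 2 < e by rewrite ltr_pdivrMr// ltr_pMr// ltr1n.
by apply/andP; split; [apply: lt_le_trans h1|apply: le_lt_trans h2 _];
  rewrite ?ltrD2l ?ltrN2.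
Qed.

(** In a chart around [x0] take a decreasing flat function of the squared Euclidean
    distance.  It vanishes outside a compact box of the chart, whose image in [M]
    is closed because [M] is Hausdorff; so extending by 0 outside the chart
    preserves smoothness. *)
Lemma bump_function (x0 : M) (W : set M) : open W -> W x0 ->
  exists (b : cinf M) (F : set M),
    [/\ closed F, F `<=` W, b x0 != 0 & forall x, ~ F x -> b x = 0].
Proof.
move=> oW Wx0; have [c ac cx0] := atlas_cover x0.
set p := cmap c x0.
have oU := @open_cmap_image _ _ _ c _ oW.
have Up : (cmap c @` (W `&` cdom c)) p by exists x0.
have [e e0 boxU] := closed_box_sub oU Up.
set box := [set v | _] in boxU.
have cbox : compact box.
  have := @rV_compact R n (fun j => `[p 0 j - e, p 0 j + e]%classic).
  by apply=> j; exact: segment_compact.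
pose F := cinv c @` box.
have FW : F `<=` W `&` cdom c.
  by move=> _ [_ /boxU[x [Wx cx] <-] <-]; rewrite (cmapK (mem_set cx)).
have cF : closed F.
  apply: compact_closed; first exact: mhausdorff.
  apply: continuous_compact cbox; apply: continuous_in_subspaceT => v /set_mem.
  by move=> /boxU[x [Wx cx] <-]; apply: cinv_cont; rewrite inE; exists x.
pose q (x : M) : R^o := \sum_(j < n) (cmap c x 0 j - p 0 j) ^+ 2.
have nF x : cdom c x -> ~ F x -> e ^+ 2 <= q x.
  move=> cx nFx; rewrite leNgt; apply/negP => qe; apply: nFx.
  exists (cmap c x); last by rewrite (cmapK (mem_set cx)).
  move=> j; rewrite /= in_itv/= -ler_distl.
  rewrite -(@ler_sqr R) ?nnegrE ?normr_ge0 ?(ltW e0)// real_normK ?num_real//.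
  apply: le_trans (ltW qe); rewrite /q (bigD1 j)//= lerDl.
  by apply: sumr_ge0 => i _; exact: sqr_ge0.
pose b (x : M) : R^o := if x \in F then flat 0 (e ^+ 2 - q x) else 0.
have bE x : cdom c x -> b x = flat 0 (e ^+ 2 - q x).
  move=> cx; rewrite /b; case: ifPn => // /negP; rewrite inE => nFx.
  by rewrite flat_eq0// subr_le0; exact: nF.
have b0 x : ~ F x -> b x = 0 by rewrite /b => nFx; rewrite memNset.
have sb : smooth_on setT b.
  apply: smooth_on_local => x _; have [Fx|nFx] := pselect (F x); last first.
    exists (~` F) => //; apply: (@eq_smooth_on _ _ _ _ (fun=> 0)).
    - exact: closed_openC.
    - by move=> y nFy; rewrite b0.
    - exact: smooth_cst.
  (* Read in another chart [d], the squared distance is a polynomial in the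
     components of the transition map, whose smoothness is the compatibility of
     the atlas. *)
  exists (cdom c); first exact: (FW _ Fx).2.
  apply: (@eq_smooth_on _ _ _ _ (fun x => flat 0 (e ^+ 2 - q x) : R^o)).
  - exact: cdom_open.
  - by move=> y cy; rewrite bE.
  move=> d ad k.
  have od := @open_cmap_image _ _ _ d _ (@cdom_open _ _ _ c).
  apply: (@Ck_flat _ _ _ _ 0%N (fun v => e ^+ 2 - q (cinv d v))) => //.
  have coord j : Ck (cmap d @` (cdom c `&` cdom d)) k
      (fun v => cmap c (cinv d v) 0 j - p 0 j : R^o).
    rewrite setIC; apply: CkD; first by rewrite setIC.
      exact: atlas_compat.
    exact: Ck_cst.
  apply: CkD => //; first exact: Ck_cst.
  have -> : (fun v => - q (cinv d v) : R^o) = (fun=> -1) *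
     \sum_(j < n) (fun v =>
       (cmap c (cinv d v) 0 j - p 0 j) * (cmap c (cinv d v) 0 j - p 0 j) : R^o).
    by apply/funext => v; rewrite fctE fct_sumE mulN1r.
  apply: CkM => //; first exact: Ck_cst.
  elim/big_ind : _ => //; first exact: Ck_cst.
    by move=> f g; exact: CkD.
  by move=> j _; apply: CkM.
exists (mk_cinf sb), F; split=> //; first by move=> x /FW[].
rewrite /= bE// /q big1 ?subr0; last by move=> j _; rewrite subrr expr0n.
by rewrite gt_eqF// flat_gt0// exprn_gt0.
Qed.

End Bump.

(** * Global sections through a prescribed vector *)

Section SectionThrough.
Variables (R : realType) (n r : nat) (M : manifold R n) (E : vbundle r M).

Section Trivialization.
Variables (a : local_triv r (fib E)) (x : M).
Hypothesis ax : tdom a x.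

Lemma trivD u v : triv a (x := x) (u + v) = triv a u + triv a v.
Proof. by have := triv_linear ax 1 u v; rewrite !scale1r. Qed.

Lemma triv0 : triv a (0 : fib E x) = 0.
Proof. by apply: (addrI (triv a (0 : fib E x))); rewrite -trivD !addr0. Qed.

Lemma trivZ k u : triv a (x := x) (k *: u) = k *: triv a u.
Proof. by have := triv_linear ax k u 0; rewrite triv0 !addr0. Qed.

Lemma triv_sum (I : Type) (s : seq I) (F : I -> fib E x) :
  triv a (\sum_(i <- s) F i) = \sum_(i <- s) triv a (F i).
Proof.
elim: s => [|i s IH]; first by rewrite !big_nil triv0.
by rewrite !big_cons trivD IH.
Qed.

Lemma triv_invE (w : 'rV[R]_r) :
  triv_inv a x w = \sum_i w 0 i *: triv_inv a x (delta_mx 0 i).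
Proof.
apply: (can_inj (trivK ax)); rewrite triv_invK// triv_sum.
rewrite [LHS]row_sum_delta; apply: eq_bigr => i _.
by rewrite trivZ triv_invK.
Qed.

End Trivialization.

(** Cut off, by a bump function supported in a trivializing open set, the section
    with constant coordinates. *)
Lemma section_through (x0 : M) (u : fib E x0) : exists s : sect E, s x0 = u.
Proof.
have [a aE ax0] := batlas_cover E x0.
have [b [F [cF Fa bx0 bF]]] := bump_function (@tdom_open _ _ _ _ _ a) ax0.
pose w := triv a u.
pose s x : fib E x := (b x / b x0) *: triv_inv a x w.
have ss : smooth_section s.
  move=> a' a'E j; apply: smooth_on_local => x a'x.
  have [Fx|nFx] := pselect (F x); last first.
    exists (tdom a' `&` ~` F) => //.
    apply: (@eq_smooth_on _ _ _ _ (fun=> 0)); last exact: smooth_cst.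
      by apply: openI; [exact: tdom_open|exact: closed_openC].
    move=> y [a'y nFy]; rewrite /s bF// mul0r scale0r triv0//.
    by rewrite mxE.
  have oaa : open (tdom a `&` tdom a') by apply: openI; exact: tdom_open.
  exists (tdom a `&` tdom a'); first by split=> //; exact: Fa.
  pose G i : M -> R^o := (fun=> w 0 i) *
    (fun x => triv a' (triv_inv a x (delta_mx 0 i)) 0 j).
  apply: (@eq_smooth_on _ _ _ _
    (((b : M -> R^o) * (fun=> (b x0)^-1)) * \sum_i G i)) => //.
    move=> y [ay a'y]; rewrite /s trivZ// mxE triv_invE// triv_sum// summxE.
    rewrite fctE fct_sumE; congr (_ * _); apply: eq_bigr => i _.
    by rewrite trivZ// mxE.
  apply: smoothM => //.
    apply: smoothM => //; last exact: smooth_cst.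
    by apply: smooth_onS (cinfP b).
  apply: smooth_on_sum => // i; apply: smoothM => //; first exact: smooth_cst.
  exact: batlas_compat.
by exists (Sect ss); rewrite /= /s divff// scale1r /w trivK.
Qed.

End SectionThrough.

(** * Pairing and gradient on a Courant algebroid *)

Section CourantCalculus.
Variables (R : realType) (n r : nat) (M : manifold R n) (E : vbundle r M).

Lemma cinf_eq (f g : cinf M) : (forall x, f x = g x) -> f = g.
Proof. by move=> fg; apply: val_inj; apply/funext. Qed.

Lemma cinfME (f g : cinf M) x : (f * g) x = f x * g x. Proof. by []. Qed.
Lemma cinfDE (f g : cinf M) x : (f + g) x = f x + g x. Proof. by []. Qed.
Lemma cinfNE (f : cinf M) x : (- f) x = - f x. Proof. by []. Qed.
Lemma cinf1E x : (1 : cinf M) x = 1. Proof. by []. Qed.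
Lemma cinfZE a (f : cinf M) x : (a *: f) x = a * f x. Proof. by []. Qed.

Lemma addsE (s t : sect E) x : (s + t) x = s x + t x.
Proof. exact: sectDE. Qed.
Lemma scalesE a (s : sect E) x : (a *: s) x = a *: s x.
Proof. exact: sectZE. Qed.
Lemma fscaleE f (s : sect E) x : fscale f s x = f x *: s x.
Proof. by rewrite /= addr0. Qed.

Variable C : courant E.
Local Notation g := (cmetric C).
Local Notation fm := (Defs.form g).
Local Notation rho := (canchor C).
Local Notation "<| X , Y |>" := (pairing g X Y).
Implicit Types (X Y Z : sect E) (f h : cinf M) (a : R).

Lemma formDl x (u v w : fib E x) : fm (u + v) w = fm u w + fm v w.
Proof. by have := Defs.form_linear g 1 u v w; rewrite scale1r mul1r. Qed.

Lemma form0l x (w : fib E x) : fm 0 w = 0.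
Proof. by apply: (addrI (fm 0 w)); rewrite -formDl !addr0. Qed.

Lemma formZl x a (u w : fib E x) : fm (a *: u) w = a * fm u w.
Proof. by have := Defs.form_linear g a u 0 w; rewrite form0l !addr0. Qed.

Lemma pairingE X Y x : <| X, Y |> x = fm (X x) (Y x). Proof. by []. Qed.
Lemma vfE X f x : vf rho X f x = anch rho (X x) f. Proof. by []. Qed.

Lemma pairingC X Y : <| X, Y |> = <| Y, X |>.
Proof. by apply: cinf_eq => x; exact: Defs.form_sym. Qed.

Lemma pairingDl X Y Z : <| X + Y, Z |> = <| X, Z |> + <| Y, Z |>.
Proof. by apply: cinf_eq => x; rewrite cinfDE !pairingE addsE formDl. Qed.

Lemma pairingZl a X Y : <| a *: X, Y |> = a *: <| X, Y |>.
Proof. by apply: cinf_eq => x; rewrite cinfZE !pairingE scalesE formZl. Qed.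

Lemma pairing_fscalel f X Y : <| fscale f X, Y |> = f * <| X, Y |>.
Proof. by apply: cinf_eq => x; rewrite cinfME !pairingE fscaleE formZl. Qed.

Lemma pairing0l X : <| 0, X |> = 0.
Proof. by apply: cinf_eq => x; rewrite pairingE form0l. Qed.

Lemma pairingNl X Y : <| - X, Y |> = - <| X, Y |>.
Proof. by rewrite -(scaleN1r X) pairingZl scaleN1r. Qed.

Lemma pairingDr X Y Z : <| X, Y + Z |> = <| X, Y |> + <| X, Z |>.
Proof. by rewrite !(pairingC X) pairingDl. Qed.
Lemma pairingZr a X Y : <| X, a *: Y |> = a *: <| X, Y |>.
Proof. by rewrite !(pairingC X) pairingZl. Qed.
Lemma pairing_fscaler f X Y : <| X, fscale f Y |> = f * <| X, Y |>.
Proof. by rewrite !(pairingC X) pairing_fscalel. Qed.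

Lemma form_inj x (u v : fib E x) : (forall w, fm u w = fm v w) -> u = v.
Proof.
move=> uv; apply/eqP; rewrite -subr_eq0; apply/eqP.
apply: (@Defs.form_nondeg _ _ _ _ _ g).
by move=> w; rewrite formDl -scaleN1r formZl uv mulN1r subrr.
Qed.

(** Fibrewise non-degeneracy passes to sections because every vector of a fibre is
    the value of a global section. *)
Lemma pairing_inj X Y : (forall Z, <| X, Z |> = <| Y, Z |>) -> X = Y.
Proof.
move=> XY; apply: sect_eq => x; apply: form_inj => w.
have [Z <-] := section_through w.
by rewrite -!pairingE XY.
Qed.

Lemma anchZ x (a : R) (u : fib E x) f : anch rho (a *: u) f = a * anch rho u f.
Proof.
have a0 : anch rho (0 : fib E x) f = 0.
  have := anch_linear rho 1 (0 : fib E x) 0 f; rewrite scaler0 addr0 mul1r.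
  by move/eqP; rewrite -subr_eq0 opprD addrA subrr sub0r oppr_eq0 => /eqP.
by have := anch_linear rho a u 0 f; rewrite a0 !addr0.
Qed.

Lemma vf_lin X a f h : vf rho X (a *: f + h) = a *: vf rho X f + vf rho X h.
Proof. by apply: cinf_eq => x; have [+ _] := anch_tangent rho (X x); apply. Qed.

Lemma vfM X f h : vf rho X (f * h) = vf rho X f * h + f * vf rho X h.
Proof. by apply: cinf_eq => x; have [_] := anch_tangent rho (X x); apply. Qed.

Definition gradient f (s : sect E) := forall X, <| s, X |> = vf rho X f.

(** The second compatibility axiom of the Dorfman bracket, read as a formula for the
    gradient of a pairing. *)
Lemma gradient_pairing Y Z : gradient <| Y, Z |> (dorf C Y Z + dorf C Z Y).
Proof. by move=> X; rewrite dorf_sym -pairingDr pairingC. Qed.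

(** With [h = <Y, Z>] not zero at [x0], the Leibniz rule gives
    [h D f = D <f Y, Z> - f D <Y, Z>], whose right-hand side is a section by
    [gradient_pairing].  Such [Y] and [Z] exist unless the bundle has rank 0, where
    every gradient is 0. *)
Lemma gradient_local f (x0 : M) : exists (h : cinf M) (t : sect E),
  h x0 != 0 /\ forall X, <| t, X |> = h * vf rho X f.
Proof.
have [u0|] := pselect (forall x (u : fib E x), u = 0).
  exists 1, 0; rewrite cinf1E oner_neq0; split=> // X.
  rewrite pairing0l mul1r; apply: cinf_eq => x.
  by rewrite vfE (u0 x (X x)) -(scale0r (0 : fib E x)) anchZ mul0r.
move=> /existsNP[x1 /existsNP[u1 u1n0]].
have r0 : (0 < r)%N.
  rewrite lt0n; apply/eqP => r0; apply: u1n0.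
  have [a _ ax] := batlas_cover E x1.
  apply: (can_inj (trivK ax)); apply/rowP => j.
  by have := ltn_ord j; rewrite [X in (_ < X)%N]r0.
have [a _ ax] := batlas_cover E x0.
pose u := triv_inv a x0 (const_mx 1).
have un0 : u <> 0.
  move=> u0; have := congr1 (triv a (x := x0)) u0.
  rewrite triv_invK// triv0// => /rowP/(_ (Ordinal r0)); rewrite !mxE => /eqP.
  by rewrite oner_eq0.
have [v uv] : exists v, fm u v <> 0.
  by apply/existsNP => h; apply: un0; exact: Defs.form_nondeg h.
have [Y Yu] := section_through u; have [Z Zv] := section_through v.
exists <| Y, Z |>.
exists ((dorf C (fscale f Y) Z + dorf C Z (fscale f Y))
        - fscale f (dorf C Y Z + dorf C Z Y)).
split=> [|X]; first by rewrite pairingE Yu Zv; apply/eqP.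
rewrite pairingDl pairingNl pairing_fscalel !gradient_pairing pairing_fscalel.
by rewrite vfM addrK mulrC.
Qed.

(** Dividing the sections [t] of [gradient_local] by [h] gives local gradients;
    non-degeneracy makes them agree on overlaps. *)
Lemma gradient_exists f : exists s, gradient f s.
Proof.
have [h /choice[t ht]] := choice (gradient_local f).
have hn0 x := (ht x).1.
pose s x : fib E x := (h x x)^-1 *: t x x.
have sE x y : h x y != 0 -> s y = (h x y)^-1 *: t x y.
  move=> hxy; apply: form_inj => w; have [X <-] := section_through w.
  rewrite !formZl.
  have e z : fm (t z y) (X y) = h z y * anch rho (X y) f.
    by rewrite -pairingE (ht z).2.
  by rewrite !e !mulrA !mulVf.
have ss : smooth_section s.
  move=> a aE j; apply: smooth_on_local => x ax.
  have oh : open [set y | h x y != 0].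
    rewrite openE => y /= hxy.
    have cy : (h x : M -> R^o) @ y --> (h x y : R^o).
      exact: smooth_on_continuous openT (cinfP (h x)) _ (in_setT y).
    have n0 : nbhs (h x y : R^o) [set z : R^o | z != 0].
      by apply: open_nbhs_nbhs; split => //; exact: (@open_neq R 0).
    exact: cy _ n0.
  have oV : open (tdom a `&` [set y | h x y != 0]).
    by apply: openI => //; exact: tdom_open.
  exists (tdom a `&` [set y | h x y != 0]); first by split=> //; exact: hn0.
  apply: (@eq_smooth_on _ _ _ _
    ((fun y => (h x y)^-1) * (fun y => triv a (t x y) 0 j))) => //.
    by move=> y [ay hy]; rewrite (sE _ _ hy) trivZ// mxE.
  apply: smoothM => //.
    apply: smooth_on_inv => //; first by move=> y [].
    exact: smooth_onS (cinfP (h x)).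
  by apply: smooth_onS (sectP (t x) aE j) => y [].
exists (Sect ss) => X; apply: cinf_eq => x; rewrite /= /s formZl.
have -> : fm (t x x) (X x) = h x x * anch rho (X x) f.
  by rewrite -pairingE (ht x).2.
by rewrite mulrA mulVf// mul1r.
Qed.

Local Notation D := (courantD C).

Lemma pairing_gradl f X : <| D f, X |> = vf rho X f.
Proof. by have := xgetPex 0 (gradient_exists f); apply. Qed.

End CourantCalculus.

(** * Unshuffles moving a single argument *)

Section Unshuffles.

(** An increasing map is determined by its image: both maps enumerate it in order. *)
Lemma incr_map_eq m n (f g : 'I_m -> 'I_n) :
  {homo f : i j / (i < j)%N} -> {homo g : i j / (i < j)%N} ->
  codom f =i codom g -> f =1 g.
Proof.
move=> finc ginc fg.
have srt (h : 'I_m -> 'I_n) : {homo h : i j / (i < j)%N} ->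
    sorted (relpre val ltn) (codom h).
  move=> hinc; rewrite /codom /image_mem sorted_map.
  have : sorted (relpre val ltn) (enum 'I_m).
    by rewrite -sorted_map val_enum_ord iota_ltn_sorted.
  exact/sub_sorted.
have e : codom f = codom g.
  apply: (@irr_sorted_eq _ (relpre val ltn)) => //; try exact: srt.
    by move=> y x z; exact: ltn_trans.
  by move=> x; exact: ltnn.
by move=> i; have /eq_in_map := e; apply; rewrite mem_enum.
Qed.

Lemma unshuffle_full m (s : 'S_m) : unshuffle m s = (s == 1%g).
Proof.
apply/idP/eqP => [/forallP us|->].
  apply/permP => i; rewrite perm1.
  apply: (@incr_map_eq _ _ s id) => // [a b ab|j].
    by have /forallP/(_ b)/implyP := us a; apply; rewrite ab ltn_ord.
  have -> : j \in codom (id : 'I_m -> 'I_m) by apply/codomP; exists j.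
  by apply/codomP; exists ((s^-1)%g j); rewrite permKV.
apply/forallP => i; apply/forallP => j; rewrite !perm1; apply/implyP.
by move=> /orP[/andP[]//|/andP[+ _]]; rewrite leqNgt ltn_ord.
Qed.

(** The permutation [lift_perm ord0 i 1] puts the [i]-th argument first and keeps
    the order of the others. *)
Lemma unshuffle1 m (s : 'S_m.+1) :
  unshuffle 1 s = (s == lift_perm ord0 (s ord0) 1).
Proof.
apply/idP/eqP => [/forallP us|sE].
  apply/permP => k; case: (unliftP ord0 k) => [j|] ->; last by rewrite lift_perm_id.
  rewrite lift_perm_lift perm1.
  apply: (@incr_map_eq _ _ (s \o lift ord0) (lift (s ord0))) => [a b ab|a b ab|i].
  - have /forallP/(_ (lift ord0 b))/implyP := us (lift ord0 a); apply.
    by rewrite !lift0 [X in _ || X]ltnS ab orbT.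
  - by rewrite /= ltnNge leq_bump2 -ltnNge.
  - have [->|] := eqVneq i (s ord0); last rewrite eq_sym => /unlift_some[k' ik' _].
      rewrite (_ : (_ \in codom (lift _)) = false); last first.
        by apply/negbTE/negP => /codomP[a /eqP]; rewrite (negbTE (neq_lift _ _)).
      apply/negbTE/negP => /codomP[a /eqP].
      by rewrite /= (inj_eq perm_inj) (negbTE (neq_lift _ _)).
    rewrite [RHS](_ : _ = true); last by apply/codomP; exists k'.
    apply/codomP; case: (unliftP ord0 ((s^-1)%g i)) => [a ea|ea].
      by exists a; rewrite /= -ea permKV.
    by move: ik'; rewrite -ea permKV => /eqP; rewrite (negbTE (neq_lift _ _)).
rewrite sE; apply/forallP => a; apply/forallP => b; apply/implyP => h.
have {h}/andP[] : (0 < a < b)%N.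
  by case/orP: h => // /andP[ab b1]; have := leq_trans ab b1.
case: (unliftP ord0 a) => [a'|] -> // _.
case: (unliftP ord0 b) => [b'|] -> //.
rewrite !lift0 !lift_perm_lift !perm1.
by rewrite ltnS /= => ab; rewrite ltnNge leq_bump2 -ltnNge.
Qed.

End Unshuffles.

(** * The Richardson-Nijenhuis bracket with a 1-form of degree 0 *)

Section RichardsonNijenhuis.
Variables (R : realType) (V : gvect R).
Implicit Types (K L T : seq V -> V) (x y : seq V) (t : V -> V).

Definition hlist x := forall v, v \in x -> exists d, homog d v.

Lemma hlistP x : (forall i, (i < size x)%N -> exists d, homog d x`_i) -> hlist x.
Proof. by move=> hx v /(nthP 0)[i ix <-]; exact: hx. Qed.

Lemma hlist_cat x y : hlist (x ++ y) <-> hlist x /\ hlist y.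
Proof.
split=> [h|[hx hy] v]; last by rewrite mem_cat => /orP[/hx|/hy].
by split=> v vx; apply: h; rewrite mem_cat vx ?orbT.
Qed.

(** Any degree of [v] may serve in a Koszul sign, and [gdeg v] is one of them, even
    for [v = 0]. *)
Lemma gdegP (v : V) d : homog d v -> homog (gdeg v) v.
Proof. by move=> hv; have := xgetPex 0 (ex_intro (fun d => homog d v) d hv). Qed.

Lemma multilinear0 L y z : multilinear L -> L (y ++ 0 :: z) = 0.
Proof.
move=> mL; have := mL y z 1 0 0; rewrite !scale1r addr0.
by move/eqP; rewrite -subr_eq0 opprD addrA subrr sub0r oppr_eq0 => /eqP.
Qed.

Lemma graded_symmetric_move L d u p y z :
  graded_symmetric L -> homog d u -> hlist y ->
  L (p ++ u :: y ++ z) =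
  (\prod_(w <- y) (-1) ^ (d * gdeg w)) *: L (p ++ y ++ u :: z).
Proof.
move=> gL du; elim: y p => [|v y IH] p hy; first by rewrite big_nil scale1r.
have [e hv] := hy v (mem_head _ _).
rewrite big_cons -scalerA /= (gL _ _ _ _ _ _ du (gdegP hv)); congr (_ *: _).
rewrite -!(cat_rcons v) IH// => w wy; apply: hy.
by rewrite inE wy orbT.
Qed.

Lemma permuted_lift u x (i : 'I_(size (u :: x))) :
  permuted (x := u :: x) (lift_perm ord0 i 1) =
  (u :: x)`_i :: take i (u :: x) ++ drop i.+1 (u :: x).
Proof.
rewrite /permuted enum_ordSl /= lift_perm_id; congr (_ :: _).
rewrite -map_comp; apply: (@eq_from_nth _ 0) => [|j].
  rewrite size_map size_enum_ord size_cat size_take size_drop ltn_ord.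
  by have := ltn_ord i; rewrite /= ltnS => /subnKC ->.
rewrite size_map size_enum_ord => jx.
rewrite (nth_map (Ordinal jx)) ?size_enum_ord//= lift_perm_lift perm1.
rewrite -[nth _ (enum _) _]/(nth (Ordinal jx) (enum 'I_(size x)) (Ordinal jx)).
rewrite nth_ord_enum.
rewrite nth_cat size_take ltn_ord /= /bump.
case: (leqP i j) => ij /=; last by rewrite nth_take.
by rewrite nth_drop subnKC// add1n.
Qed.

(** The inversions of this permutation are the pairs formed by the first position
    and an argument that preceded the [i]-th one. *)
Lemma koszul_lift u x (i : 'I_(size (u :: x))) :
  koszul (x := u :: x) (lift_perm ord0 i 1) =
  \prod_(w <- take i (u :: x)) (-1) ^ (gdeg (u :: x)`_i * gdeg w).
Proof.
set y := u :: x; set s := lift_perm _ _ _.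
have s0 : s ord0 = i by exact: lift_perm_id.
rewrite /koszul (bigD1 ord0)//= [X in _ * X]big1 ?mulr1; last first.
  move=> a a0; rewrite big1// => b /andP[ab sba]; exfalso; move: ab sba.
  case: (unliftP ord0 a) a0 => [a'|] -> // _.
  case: (unliftP ord0 b) => [b'|] -> //.
  by rewrite !lift0 ltnS !lift_perm_lift !perm1 => ab; rewrite ltnNge leq_bump2 ltnW.
rewrite (eq_bigl (fun b => (s b < i)%N)); last first.
  move=> b; rewrite s0; case: (posnP b) => [b0|//].
  by rewrite (_ : b = ord0) ?s0 ?ltnn//; exact: val_inj.
rewrite s0.
pose F c : R := (-1) ^ (gdeg y`_i * gdeg y`_c).
rewrite -(reindex_inj (h := s) (P := fun c => (c < i)%N) (F := F) perm_inj).
rewrite -(big_ord_widen _ F (ltnW (ltn_ord i))).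
rewrite -(map_nth_iota0 0 (ltnW (ltn_ord i))) big_map.
by rewrite -[X in iota _ X]subn0 big_mkord.
Qed.

Lemma hlist_permuted x (s : 'S_(size x)) : hlist x -> hlist (permuted s).
Proof. by move=> hx v /mapP[i _ ->]; apply: hx; rewrite mem_nth. Qed.

Lemma size_permuted x (s : 'S_(size x)) : size (permuted s) = size x.
Proof. by rewrite size_map size_enum_ord. Qed.

Section OneForm.
Variable T : seq V -> V.
Hypothesis T1 : is_kform 1 T.
Hypothesis Thomog : forall d v, homog d v -> homog d (T [:: v]).

Lemma hlist_insert x (s : 'S_(size x)) k : hlist x ->
  hlist (T (take k (permuted s)) :: drop k (permuted s)).
Proof.
move=> /(@hlist_permuted _ s); rewrite -{1}(cat_take_drop k (permuted s)).
move=> /hlist_cat[h1 h2]; apply/(hlist_cat [:: _]); split => // _ /[1!inE]/eqP->.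
move: (take _ _) h1 => [|v [|w y]] h.
- by exists 0; rewrite T1//; exact: homog0.
- by have [d dv] := h v (mem_head _ _); exists d; exact: Thomog.
- by exists 0; rewrite T1//; exact: homog0.
Qed.

(** Koszul signs make sense on homogeneous arguments only, so a form that is itself
    an RN bracket is known there only; that is all an insertion looks at. *)
Lemma eq_insertion L L' x : (forall y, hlist y -> L y = L' y) -> hlist x ->
  insertion T L x = insertion T L' x.
Proof.
move=> e hx; apply: eq_bigr => k _; apply: eq_bigr => s _; congr (_ *: _).
exact/e/hlist_insert.
Qed.

(** Only the insertions of [T] at one argument survive; moving [T x_i] back to its
    place costs the Koszul sign once more, since [T] preserves degrees. *)
Lemma insertion_1form L x : multilinear L -> graded_symmetric L -> hlist x ->
  insertion T L x =
  \sum_(i < size x) L (take i x ++ T [:: x`_i] :: drop i.+1 x).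
Proof.
move=> mL gL hx; rewrite /insertion.
have z k (s : 'S_(size x)) : (k <= size x)%N -> k != 1%N ->
    L (T (take k (permuted s)) :: drop k (permuted s)) = 0.
  move=> kx k1; rewrite T1 ?(@multilinear0 L [::])// size_takel//.
  by rewrite size_permuted.
case: x hx z => [|u x] hx z.
  rewrite [RHS]big_ord0 big1 // => k _; rewrite big1 // => s _; rewrite z ?scaler0//.
    by rewrite -ltnS.
  by have := ltn_ord k; rewrite ltnS leqn0 => /eqP ->.
rewrite (bigD1 (lift ord0 ord0))//= [X in _ + X]big1 ?addr0; last first.
  move=> k k1; rewrite big1// => s _; rewrite z ?scaler0// -ltnS//.
rewrite (reindex_onto (fun i => lift_perm ord0 i 1) (fun s => s ord0)); last first.
  by move=> s; rewrite unshuffle1 => /eqP <-.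
apply: eq_big => [i|i _].
  by rewrite unshuffle1 lift_perm_id !eqxx.
have [d hd] : exists d, homog d (u :: x)`_i by apply: hx; rewrite mem_nth.
rewrite koszul_lift permuted_lift /= take0 drop0.
rewrite (@graded_symmetric_move L _ _ [::] _ _ gL (Thomog (gdegP hd)))//.
  rewrite /= scalerA -big_split big1 ?scale1r// => w _ /=.
  by rewrite -expfzMl mulrNN mulr1 exp1rz.
by move=> v vx; apply: hx; exact: mem_take vx.
Qed.

(** [T] only accepts the value of [L] on all the arguments, in their order. *)
Lemma insertion_into_1form L x : T [:: 0] = 0 -> insertion L T x = T [:: L x].
Proof.
move=> T0; rewrite /insertion (bigD1 ord_max)//= [X in _ + X]big1 ?addr0.
  rewrite (eq_bigl (pred1 1%g)) ?big_pred1_eq; last first.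
    by move=> s; rewrite unshuffle_full.
  have -> : permuted (1%g : 'S_(size x)) = x.
    rewrite /permuted (eq_map (g := nth 0 x \o val)); last first.
      by move=> i; rewrite perm1.
    by rewrite map_comp val_enum_ord map_nth_iota0// take_size.
  rewrite take_size drop_size /koszul big1 ?scale1r// => i _; rewrite big1// => j.
  by rewrite !perm1 => /andP[/ltn_trans h /h]; rewrite ltnn.
move=> k km; rewrite big1// => s _; rewrite T1 ?scaler0// /= size_drop size_permuted.
rewrite eqSS subn_eq0 -ltnNge.
have := ltn_ord k; rewrite ltnS leq_eqVlt => /orP[/eqP kx|//].
by case/eqP: km; apply/val_inj.
Qed.

(** The derivation of the algebra of forms defined by [T], free of Koszul signs. *)
Definition ad L x : V :=
  \sum_(i < size x) L (take i x ++ T [:: x`_i] :: drop i.+1 x) - T [:: L x].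

(** The form [L'] may differ from [L] on inhomogeneous arguments: this lets the
    lemma be iterated, an RN bracket not being multilinear there. *)
Lemma RN_1form L L' d x : (forall y, hlist y -> L y = L' y) ->
  multilinear L' -> graded_symmetric L' -> T [:: 0] = 0 -> hlist x ->
  RN 0 d T L x = ad L' x.
Proof.
move=> e mL gL T0 hx; rewrite /RN mul0r expr0z scale1r (eq_insertion e hx).
by rewrite insertion_1form// insertion_into_1form// e.
Qed.

End OneForm.

End RichardsonNijenhuis.

(** * Forms with the shape of a Lie 2-algebra structure *)

Lemma linear_at0 (R : pzRingType) (U W : lmodType R) (f : U -> W) :
  (forall a u v, f (a *: u + v) = a *: f u + f v) -> f 0 = 0.
Proof.
move=> lf; apply: (addrI (f 0)).
by rewrite -{1}[f 0]scale1r -lf scaler0 !addr0.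
Qed.

Section BracketData.
Variables (R : realType) (n r : nat) (M : manifold R n) (E : vbundle r M).
Local Notation V := (cE_gvect E).
Implicit Types (f h lam : cinf M) (X Y Z : sect E) (a : R) (u v w : V).

(** Components of a degree 1 form of arity at most 3 on functions in degree -2 and
    sections in degree -1: degree reasons leave just these four. *)
Record bracket_data := BracketData {
  unary : cinf M -> sect E;
  mixed : sect E -> cinf M -> cinf M;
  binary : sect E -> sect E -> sect E;
  ternary : sect E -> sect E -> sect E -> cinf M }.

Implicit Type B : bracket_data.

Record bracket_axioms B : Prop := BracketAxioms {
  unary_linear : forall a f h, unary B (a *: f + h) = a *: unary B f + unary B h;
  mixed_linearl : forall a X Y f,
    mixed B (a *: X + Y) f = a *: mixed B X f + mixed B Y f;
  mixed_linearr : forall a X f h,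
    mixed B X (a *: f + h) = a *: mixed B X f + mixed B X h;
  binary_linear : forall a X Y Z,
    binary B (a *: X + Y) Z = a *: binary B X Z + binary B Y Z;
  binary_skew : forall X Y, binary B X Y = - binary B Y X;
  ternary_linear : forall a X Y Z W,
    ternary B (a *: X + Y) Z W = a *: ternary B X Z W + ternary B Y Z W;
  ternary_skew12 : forall X Y Z, ternary B X Y Z = - ternary B Y X Z;
  ternary_skew23 : forall X Y Z, ternary B X Y Z = - ternary B X Z Y }.

Lemma bracket_linear B : bracket_axioms B ->
  (forall a X Y Z, binary B Z (a *: X + Y) = a *: binary B Z X + binary B Z Y) *
  (forall a X Y Z W,
     ternary B Z (a *: X + Y) W = a *: ternary B Z X W + ternary B Z Y W) *
  (forall a X Y Z W,
     ternary B Z W (a *: X + Y) = a *: ternary B Z W X + ternary B Z W Y).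
Proof.
move=> [_ _ _ bl bs tl t12 t23]; split; [split|] => [a X Y Z|a X Y Z W|a X Y Z W].
- by rewrite !(bs Z) bl opprD scalerN.
- by rewrite !(t12 Z) tl opprD scalerN.
- by rewrite !(t23 Z W) !(t12 Z) tl opprD scalerN opprD scalerN !opprK.
Qed.

Lemma bracket0 B : bracket_axioms B ->
  (unary B 0 = 0) * (forall f, mixed B 0 f = 0) * (forall X, mixed B X 0 = 0) *
  (forall X, binary B 0 X = 0) * (forall X, binary B X 0 = 0) *
  (forall X Y, ternary B 0 X Y = 0) * (forall X Y, ternary B X 0 Y = 0) *
  (forall X Y, ternary B X Y 0 = 0).
Proof.
move=> hB; have lin := bracket_linear hB; case: hB => [l1 ml mr bl _ tl _ _].
refine (_, _, _, _, _, _, _, _) => [|f|X|X|X|X Y|X Y|X Y].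
- exact: linear_at0.
- by apply: (linear_at0 (f := mixed B ^~ f)) => a X Y; exact: ml.
- by apply: (linear_at0 (f := mixed B X)) => a f h; exact: mr.
- exact: (linear_at0 (f := binary B ^~ X)).
- by apply: (linear_at0 (f := binary B X)) => a Z W; rewrite lin.
- exact: (linear_at0 (f := fun Z => ternary B Z X Y)).
- by apply: (linear_at0 (f := ternary B X ^~ Y)) => a Z W; rewrite lin.
- by apply: (linear_at0 (f := ternary B X Y)) => a Z W; rewrite lin.
Qed.

Definition brackets B (x : seq V) : V :=
  match x with
  | [:: u] => (0, unary B u.1)
  | [:: u; v] => (mixed B u.2 v.1 + mixed B v.2 u.1, binary B u.2 v.2)
  | [:: u; v; w] => (ternary B u.2 v.2 w.2, 0)
  | _ => 0
  end.

Lemma brackets_gt3 B x : (3 < size x)%N -> brackets B x = 0.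
Proof. by case: x => [|u [|v [|w [|z x]]]]. Qed.

Lemma cinf_mulZr a f h : f * (a *: h) = a *: (f * h).
Proof. by apply: cinf_eq => x; rewrite !(cinfZE, cinfME) mulrCA. Qed.

Lemma pair_eq u v : u.1 = v.1 -> u.2 = v.2 -> u = v.
Proof. by case: u v => [f X] [h Y] /= -> ->. Qed.

Lemma brackets_multilinear B : bracket_axioms B -> multilinear (brackets B).
Proof.
move=> hB; have lin := bracket_linear hB; case: hB => [l1 ml mr bl _ tl _ _].
have z0 a : 0 = a *: 0 + 0 :> V by rewrite scaler0 addr0.
case=> [|w1 [|w2 [|w3 s]]] [|z1 [|z2 [|z3 t]]] a u v; try exact: z0; last first.
all: try by case: s => [|? ?]; exact: z0.
all: apply: pair_eq; rewrite /= ?l1 ?ml ?mr ?bl ?tl ?lin ?scaler0 ?addr0 //.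
all: by rewrite scalerDr addrACA.
Qed.

Lemma homog_cases d v : homog d v ->
  [\/ v = 0, d = - 1 /\ v.1 = 0 | d = - 2 /\ v.2 = 0].
Proof.
move=> [v1 v2]; have [d1|d1] := eqVneq d (- 1).
  by apply: Or32; split=> //; apply: v1; rewrite d1.
have [d2|d2] := eqVneq d (- 2).
  by apply: Or33; split=> //; apply: v2; rewrite d2.
by apply: Or31; apply: pair_eq; [exact: v1|exact: v2].
Qed.

Lemma brackets_graded_symmetric B :
  bracket_axioms B -> graded_symmetric (brackets B).
Proof.
move=> hB; have mB := brackets_multilinear hB; have zero := bracket0 hB.
case: hB => [_ _ _ _ bs _ t12 t23].
have z0 (k : R) : 0 = k *: 0 :> V by rewrite scaler0.
have sz s t p q u v : (3 < size (s ++ u :: v :: t))%N ->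
    brackets B (s ++ u :: v :: t) = (-1) ^ (p * q) *: brackets B (s ++ v :: u :: t).
  move=> sz; rewrite !brackets_gt3 ?scaler0//.
  by move: sz; rewrite !size_cat.
move=> s t p q u v /homog_cases hu /homog_cases hv.
have [|st] := ltnP 3 (size (s ++ u :: v :: t)); first exact: sz.
have {}st : (size s + size t < 2)%N by move: st; rewrite size_cat /=; lia.
case: hu => [->|[pE u1]|[pE u2]].
- by rewrite -(cat_rcons v) !(multilinear0 _ _ mB) scaler0.
- case: hv => [->|[qE v1]|[qE v2]].
  + by rewrite -(cat_rcons u) !(multilinear0 _ _ mB) scaler0.
  + rewrite pE qE (_ : - 1 * - 1 = 1 :> int)// expr1z scaleN1r.
    case: s t st => [|w1 [|w2 s]] [|z1 [|z2 t]] //= _; apply: pair_eq;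
      rewrite /= ?u1 ?v1 ?zero ?addr0 ?oppr0//.
  + rewrite pE qE (_ : - 1 * - 2 = 2 :> int)// -exprnP sqrrN expr1n scale1r.
    case: s t st => [|w1 [|w2 s]] [|z1 [|z2 t]] //= _; apply: pair_eq;
      rewrite /= ?u1 ?v2 ?zero ?addr0 ?add0r //.
- case: hv => [->|[qE v1]|[qE v2]].
  + by rewrite -(cat_rcons u) !(multilinear0 _ _ mB) scaler0.
  + rewrite pE qE (_ : - 2 * - 1 = 2 :> int)// -exprnP sqrrN expr1n scale1r.
    case: s t st => [|w1 [|w2 s]] [|z1 [|z2 t]] //= _; apply: pair_eq;
      rewrite /= ?u2 ?v1 ?zero ?addr0 ?add0r //.
  + rewrite pE qE (_ : - 2 * - 2 = 4 :> int)// -exprnP (exprM _ 2 2) sqrrN.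
    rewrite !expr1n scale1r.
    case: s t st => [|w1 [|w2 s]] [|z1 [|z2 t]] //= _; apply: pair_eq;
      rewrite /= ?u2 ?v2 ?zero ?addr0 ?add0r //.
Qed.

Lemma brackets_degree B : bracket_axioms B -> has_degree 1 (brackets B).
Proof.
move=> /bracket0 zero y hy; have [y3|] := ltnP 3 (size y).
  by rewrite brackets_gt3 ?size_map//; exact: homog0.
have {}hy p (py : p \in y) := homog_cases (hy p py).
case: y hy => [|p1 [|p2 [|p3 [|//]]]] hy _; rewrite ?big_cons ?big_nil.
- exact: homog0.
- by case: (hy p1 (mem_head _ _)) => [e1|[-> e1]|[-> e1]]; split=> //= _;
    rewrite ?e1 ?zero.
- have := hy p2; rewrite !inE eqxx orbT => /(_ isT) h2.
  by case: (hy p1 (mem_head _ _)) => [e1|[-> e1]|[-> e1]];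
    case: h2 => [e2|[-> e2]|[-> e2]]; split=> //= _;
    rewrite ?e1 ?e2 ?zero ?addr0.
- have := hy p2; rewrite !inE eqxx orbT => /(_ isT) h2.
  have := hy p3; rewrite !inE eqxx !orbT => /(_ isT) h3.
  by case: (hy p1 (mem_head _ _)) => [e1|[-> e1]|[-> e1]];
    case: h2 => [e2|[-> e2]|[-> e2]]; case: h3 => [e3|[-> e3]|[-> e3]];
    split=> //= _; rewrite ?e1 ?e2 ?e3 ?zero.
Qed.

Lemma brackets_sym B : bracket_axioms B -> sym_form 1 (brackets B).
Proof.
move=> hB; split; first exact: brackets_multilinear.
  exact: brackets_graded_symmetric.
exact: brackets_degree.
Qed.

Section OneFormAd.
Variables (N : sect E -> sect E) (lam : cinf M).
Hypothesis N_linear : forall a X Y, N (a *: X + Y) = a *: N X + N Y.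

Lemma one_form_is1 : is_kform 1 (one_form N lam).
Proof. by case=> [|u [|v x]]. Qed.

Lemma one_form0 : one_form N lam [:: 0 : V] = 0.
Proof.
apply: pair_eq; rewrite /= ?mulr0//.
exact: linear_at0.
Qed.

Lemma one_form_homog d v : homog d v -> homog d (one_form N lam [:: v]).
Proof.
have N0 : N 0 = 0 by exact: linear_at0.
by move=> [v1 v2]; split=> /= dd; rewrite ?v1 ?v2 ?mulr0.
Qed.

Lemma one_form_sym : sym_form 0 (one_form N lam : seq V -> V).
Proof.
split.
- case=> [|w s] [|z t] a u v; try by case: s => [|? ?]; rewrite /= scaler0 addr0.
    apply: pair_eq; rewrite /= ?N_linear// mulrDr; congr (_ + _).
    exact: cinf_mulZr.
  by rewrite /= scaler0 addr0.
- by case=> [|w [|w2 s]] t p q u v _ _; rewrite /= scaler0.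
- case=> [|p [|q y]] h; rewrite ?big_cons ?big_nil ?addr0; try exact: homog0.
  by apply: one_form_homog; apply: (h p); exact: mem_head.
Qed.

(** The components of [ [T, L] ], where [T] is [N] on sections and [lam] on
    functions. *)
Definition deform B : bracket_data := BracketData
  (fun f => unary B (lam * f) - N (unary B f))
  (fun X f => mixed B (N X) f + mixed B X (lam * f) - lam * mixed B X f)
  (fun X Y => binary B (N X) Y + binary B X (N Y) - N (binary B X Y))
  (fun X Y Z => ternary B (N X) Y Z + ternary B X (N Y) Z + ternary B X Y (N Z)
                - lam * ternary B X Y Z).

Lemma ad_brackets B x : ad (one_form N lam) (brackets B) x = brackets (deform B) x.
Proof.
have N0 : N 0 = 0 by exact: linear_at0.
have [x3|] := ltnP 3 (size x).
  rewrite brackets_gt3 /ad // big1 => [|i _].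
    by rewrite brackets_gt3// one_form0 subr0.
  rewrite brackets_gt3// size_cat /= size_takel ?(ltnW (ltn_ord i))// size_drop.
  by rewrite -addSnnS subnKC ?ltn_ord.
case: x => [|u [|v [|w [|//]]]] _; rewrite /ad /= ?big_ord_recl ?big_ord0 /= ?addr0.
- by apply: pair_eq; rewrite /= ?mulr0 ?N0 subr0.
- by apply: pair_eq; rewrite /= ?mulr0 ?subr0.
- apply: pair_eq; rewrite /=; last by [].
  by apply: cinf_eq => x; rewrite !(cinfDE, cinfNE, cinfZE, cinfME); ring.
- apply: pair_eq; rewrite /= ?addr0 ?add0r ?N0 ?subr0 ?oppr0 ?addrA//.
Qed.

Lemma deform_axioms B : bracket_axioms B -> bracket_axioms (deform B).
Proof.
move=> hB; have lin := bracket_linear hB; case: hB => [l1 ml mr bl bs tl t12 t23].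
have NN X : N (- X) = - N X.
  have := N_linear (-1) X 0; rewrite addr0 !scaleN1r => ->.
  by rewrite (linear_at0 N_linear) addr0.
have lamD a f h : lam * (a *: f + h) = a *: (lam * f) + lam * h.
  by rewrite mulrDr cinf_mulZr.
split=> /=.
- by move=> a f h; rewrite lamD !l1 N_linear opprD addrACA -scalerBr.
- move=> a X Y f; rewrite N_linear !ml lamD; apply: cinf_eq => x.
  by rewrite !(cinfDE, cinfNE, cinfZE, cinfME); ring.
- move=> a X f h; rewrite !mr !lamD !mr; apply: cinf_eq => x.
  by rewrite !(cinfDE, cinfNE, cinfZE, cinfME); ring.
- move=> a X Y Z; rewrite !N_linear !bl !N_linear opprD !scalerDr scalerN.
  by rewrite [X in X + _ = _]addrACA [LHS]addrACA.
- move=> X Y; rewrite (bs (N X)) (bs X (N Y)) (bs X) NN !opprD !opprK.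
  by rewrite (addrC (- binary B Y (N X))).
- move=> a X Y Z W; rewrite !N_linear !tl lamD; apply: cinf_eq => x.
  by rewrite !(cinfDE, cinfNE, cinfZE, cinfME); ring.
- move=> X Y Z; rewrite (t12 (N X)) (t12 X (N Y)) (t12 X Y (N Z)) (t12 X Y Z).
  by apply: cinf_eq => x; rewrite !(cinfDE, cinfNE, cinfZE, cinfME); ring.
- move=> X Y Z; rewrite (t23 (N X)) (t23 X (N Y)) (t23 X Y (N Z)) (t23 X Y Z).
  by apply: cinf_eq => x; rewrite !(cinfDE, cinfNE, cinfZE, cinfME); ring.
Qed.

Lemma RN_brackets B (L : seq V -> V) x : bracket_axioms B ->
  (forall y, hlist y -> L y = brackets B y) -> hlist x ->
  RN 0 1 (one_form N lam) L x = brackets (deform B) x.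
Proof.
move=> hB LB hx.
have mB := brackets_multilinear hB; have gB := brackets_graded_symmetric hB.
rewrite (RN_1form _ _ _ LB)// ?ad_brackets//; first exact: one_form_is1.
  by move=> d v; exact: one_form_homog.
exact: one_form0.
Qed.

End OneFormAd.

End BracketData.

(** * Deforming the Lie 2-algebra of a Courant algebroid *)

Lemma eq_brackets (R : realType) (n r : nat) (M : manifold R n) (E : vbundle r M)
    (B B' : bracket_data E) :
  unary B =1 unary B' -> mixed B =2 mixed B' -> binary B =2 binary B' ->
  (forall X Y Z, ternary B X Y Z = ternary B' X Y Z) ->
  brackets B =1 brackets B'.
Proof.
by move=> e1 em e2 e3 [|u [|v [|w [|z x]]]] //=; rewrite ?e1 ?em ?e2 ?e3.
Qed.

Section CourantBrackets.
Variables (R : realType) (n r : nat) (M : manifold R n) (E : vbundle r M).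
Variable C : courant E.
Local Notation g := (cmetric C).
Local Notation rho := (canchor C).
Local Notation "<| X , Y |>" := (pairing g X Y).
Local Notation D := (courantD C).
Local Notation br := (skew_bracket C).
Implicit Types (X Y Z : sect E) (f h lam gam : cinf M) (a : R).
Implicit Type N : sect E -> sect E.

Lemma courantD_linear a f h : D (a *: f + h) = a *: D f + D h.
Proof.
apply: (pairing_inj (C := C)) => Z.
by rewrite pairingDl pairingZl !pairing_gradl vf_lin.
Qed.

(** The Leibniz rule, the term in [D lam] being zero. *)
Lemma courantD_casimir lam f : casimir C lam -> D (lam * f) = fscale lam (D f).
Proof.
move=> cl; apply: (pairing_inj (C := C)) => Z.
by rewrite pairing_fscalel !pairing_gradl vfM cl mul0r add0r.
Qed.

Lemma skew_bracketC X Y : br X Y = - br Y X.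
Proof. by rewrite /skew_bracket -scalerN opprB. Qed.

Lemma skew_bracket_linear a X Y Z : br (a *: X + Y) Z = a *: br X Z + br Y Z.
Proof.
rewrite /skew_bracket dorf_linearl dorf_linearr opprD addrACA -scalerBr scalerDr.
by rewrite !scalerA mulrC.
Qed.

Definition cyclic_pairing (b : sect E -> sect E -> sect E) X Y Z : cinf M :=
  6%:R^-1 *: (<| b X Y, Z |> + <| b Y Z, X |> + <| b Z X, Y |>).

Definition courant_data : bracket_data E :=
  BracketData D (fun X f => 2%:R^-1 *: <| X, D f |>) br (cyclic_pairing br).

Lemma courant_muE x : courant_mu C x = brackets courant_data x.
Proof.
rewrite /courant_mu; case: x => [|u [|v [|w [|z x]]]]; rewrite ?addr0 ?add0r//=.
by rewrite scalerDr.
Qed.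

Lemma courant_data_axioms : bracket_axioms courant_data.
Proof.
split=> /=.
- exact: courantD_linear.
- by move=> a X Y f; rewrite pairingDl pairingZl scalerDr !scalerA mulrC.
- move=> a X f h; rewrite courantD_linear pairingDr pairingZr scalerDr.
  by rewrite !scalerA mulrC.
- exact: skew_bracket_linear.
- exact: skew_bracketC.
- move=> a X Y Z W; rewrite /cyclic_pairing !(skew_bracketC W) !skew_bracket_linear.
  rewrite !(pairingDl, pairingNl, pairingZl, pairingDr, pairingZr).
  by apply: cinf_eq => x; rewrite !(cinfDE, cinfNE, cinfZE, cinfME); field.
- move=> X Y Z; rewrite /cyclic_pairing (skew_bracketC Y X) (skew_bracketC X Z).
  rewrite (skew_bracketC Z Y) !pairingNl.
  by apply: cinf_eq => x; rewrite !(cinfDE, cinfNE, cinfZE, cinfME); field.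
- move=> X Y Z; rewrite /cyclic_pairing (skew_bracketC X Z) (skew_bracketC Z Y).
  rewrite (skew_bracketC Y X) !pairingNl.
  by apply: cinf_eq => x; rewrite !(cinfDE, cinfNE, cinfZE, cinfME); field.
Qed.

(** The condition [N + N' = lam Id], without mention of the transpose [N']. *)
Definition anti_selfadjoint lam N := forall X Y,
  <| N X, Y |> + <| X, N Y |> = lam * <| X, Y |>.

Lemma transpose_anti_selfadjoint N Ns lam : transpose C N Ns ->
  (forall X, N X + Ns X = fscale lam X) -> anti_selfadjoint lam N.
Proof.
move=> tN hN X Y; rewrite tN -pairingDr addrC hN.
by rewrite pairing_fscaler.
Qed.

Lemma tensor11_linear N : tensor11 N ->
  forall a X Y, N (a *: X + Y) = a *: N X + N Y.
Proof.
move=> tN a X Y.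
have e Z : fscale (a *: (1 : cinf M)) Z = a *: Z.
  by apply: sect_eq => x; rewrite [LHS]fscaleE [RHS]scalesE cinfZE cinf1E mulr1.
by rewrite -!e tN.
Qed.

(** The transpose [N'] of [N] is [lam - N], so that
    [N^2 + N' N' = 2 N^2 - 2 lam N + lam^2], and this equals [gam]. *)
Lemma square_formula N lam gam : anti_selfadjoint lam N ->
  anti_selfadjoint gam (N \o N) -> forall X,
  N (N X) = fscale lam (N X) + fscale (2%:R^-1 *: (gam - lam ^+ 2)) X.
Proof.
(* The letters stand for pairings of [X] and [Z] hit by powers of [N]. *)
have elim_products (l m a b c d e k : R) : e + k = m * a -> d + k = l * c ->
    e + d = l * b -> b + c = l * a -> e = l * b + 2%:R^-1 * (m - l * l) * a.
  move=> h1 h2 h3 h4.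
  have -> : e = 2%:R^-1 * ((e + d) - (d + k) + (e + k)) by field.
  rewrite h1 h2 h3 (_ : c = l * a - b); first by field.
  by rewrite -h4 addrC addKr.
move=> aN aN2 X; apply: (pairing_inj (C := C)) => Z.
rewrite pairingDl !pairing_fscalel; apply: cinf_eq => x.
have := congr1 (fun f : cinf M => f x) (aN X Z).
have := congr1 (fun f : cinf M => f x) (aN (N X) Z).
have := congr1 (fun f : cinf M => f x) (aN X (N Z)).
have := congr1 (fun f : cinf M => f x) (aN2 X Z).
rewrite expr2 !(cinfDE, cinfNE, cinfZE, cinfME).
exact: elim_products.
Qed.

(** For [b] the binary bracket, [<b, N Z> - lam <b, Z> = - <N b, Z>]: the term
    [- lam l3] of the deformation turns the argument [N Z] into the term [- N b] of
    the deformed bracket. *)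
Lemma deform_cyclic_pairing (B : bracket_data E) N lam :
  anti_selfadjoint lam N ->
  (forall X Y Z, ternary B X Y Z = cyclic_pairing (binary B) X Y Z) ->
  forall X Y Z, ternary (deform N lam B) X Y Z =
    cyclic_pairing (binary (deform N lam B)) X Y Z.
Proof.
move=> aN tB X Y Z; rewrite /= !tB /cyclic_pairing.
have e U W : <| N U, W |> = lam * <| U, W |> - <| U, N W |> by rewrite -aN addrK.
rewrite !pairingDl !pairingNl !e.
by apply: cinf_eq => x; rewrite !(cinfDE, cinfNE, cinfZE, cinfME); ring.
Qed.

(** The torsion of the skew bracket is half the antisymmetrization of the torsion of
    the Dorfman bracket. *)
Lemma skew_torsion0 N : (forall a X Y, N (a *: X + Y) = a *: N X + N Y) ->
  (forall X Y, torsion C N X Y = 0) ->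
  forall X Y, br (N X) (N Y) = N (br (N X) Y + br X (N Y) - N (br X Y)).
Proof.
move=> lN t0 X Y.
have e U W : dorf C (N U) (N W) = N (dorf_def C N U W).
  by apply/eqP; rewrite -subr_eq0; apply/eqP; exact: t0.
have NB U W : N (U - W) = N U - N W by rewrite addrC -scaleN1r lN scaleN1r addrC.
have NZ a U : N (a *: U) = a *: N U.
  by rewrite -[a *: U]addr0 lN (linear_at0 lN) addr0.
rewrite /skew_bracket !e -NB -NZ; congr N.
rewrite NZ -scalerDr -scalerBr; congr (_ *: _).
rewrite /dorf_def NB !opprD !opprK addrACA; congr (_ + _).
by rewrite (addrC (- dorf C (N Y) X)) addrACA.
Qed.

(** The components agree one by one; only the binary one uses the torsion, and the
    ternary one follows from it. *)
Lemma deform_courant_twice N lam gam :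
  (forall a X Y, N (a *: X + Y) = a *: N X + N Y) ->
  (forall X Y, torsion C N X Y = 0) ->
  anti_selfadjoint lam N -> anti_selfadjoint gam (N \o N) ->
  casimir C lam -> casimir C gam ->
  brackets (deform N lam (deform N lam courant_data)) =1
  brackets (deform (N \o N) gam courant_data).
Proof.
move=> lN t0 aN aN2 cl cg.
have NN U : N (- U) = - N U.
  by rewrite -scaleN1r -[_ *: U]addr0 lN (linear_at0 lN) addr0 scaleN1r.
have ND U W : N (U + W) = N U + N W by rewrite -[U]scale1r lN !scale1r.
have e U W : <| N U, W |> = lam * <| U, W |> - <| U, N W |> by rewrite -aN addrK.
have e2 U W : <| N (N U), W |> = gam * <| U, W |> - <| U, N (N W) |>.
  by rewrite -aN2 addrK.
have binE X Y : binary (deform N lam (deform N lam courant_data)) X Y =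
    binary (deform (N \o N) gam courant_data) X Y.
  have := skew_torsion0 lN t0 X Y; rewrite /= !(ND, NN) => h.
  apply: (pairing_inj (C := C)) => Z; rewrite !(pairingDl, pairingNl).
  have := congr1 (fun U => <| U, Z |>) h; rewrite /= !(pairingDl, pairingNl) => ->.
  by apply: cinf_eq => x; rewrite !(cinfDE, cinfNE, cinfZE, cinfME); ring.
apply: eq_brackets => [f|X f|//|X Y Z].
- apply: (pairing_inj (C := C)) => Z; rewrite /=.
  rewrite !(courantD_casimir _ cl, courantD_casimir _ cg).
  (* Using [e2] on the right only reduces both sides to [<D f, N^2 Z>]. *)
  rewrite ND NN !(pairingDl, pairingNl) [in RHS]e2 !(pairing_fscalel, e).
  by apply: cinf_eq => x; rewrite !(cinfDE, cinfNE, cinfZE, cinfME); ring.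
- rewrite /= !(courantD_casimir _ cl, courantD_casimir _ cg) !pairing_fscaler.
  by apply: cinf_eq => x; rewrite !(cinfDE, cinfNE, cinfZE, cinfME); ring.
- have d1 := deform_cyclic_pairing (B := courant_data) aN.
  rewrite (deform_cyclic_pairing aN (d1 _))//.
  rewrite (deform_cyclic_pairing (B := courant_data) aN2)//.
  by rewrite /cyclic_pairing !binE.
Qed.

End CourantBrackets.

Theorem proposition2p6p16 (R : realType) (n r : nat) (M : manifold R n)
    (E : vbundle r M) (C : courant E) (N Nstar N2star : sect E -> sect E)
    (lam gam : cinf M)
    (hN : tensor11 N)
    (hNstar : transpose C N Nstar)
    (hN2star : transpose C (N \o N) N2star)
    (htorsion : forall X Y, torsion C N X Y = 0)
    (hlam : casimir C lam)
    (hgam : casimir C gam)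
    (hN_lam : forall X, N X + Nstar X = fscale lam X)
    (hN2_gam : forall X, N (N X) + N2star X = fscale gam X) :
  (forall X, N (N X) =
     fscale lam (N X) + fscale (2%:R^-1 *: (gam - lam ^+ 2)) X) /\
  is_kform 1 (one_form N lam) /\
  is_kform 1 (one_form (N \o N) gam) /\
  nijenhuis (courant_mu C) (one_form N lam) (one_form (N \o N) gam).
Proof.
have aN := transpose_anti_selfadjoint hNstar hN_lam.
have aN2 := transpose_anti_selfadjoint hN2star hN2_gam.
have lN := tensor11_linear hN.
have lN2 a X Y : (N \o N) (a *: X + Y) = a *: (N \o N) X + (N \o N) Y.
  by rewrite /= !lN.
have axioms := courant_data_axioms C.
have axiomsN := deform_axioms lam lN axioms.
split; first exact: (square_formula aN aN2).
split; first exact: one_form_is1.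
split; first exact: one_form_is1.
split.
- have -> : courant_mu C = brackets (courant_data C).
    by apply/funext => x; exact: courant_muE.
  exact: brackets_sym.
- exact: one_form_sym.
- exact: one_form_sym.
- move=> x /hlistP hx.
  rewrite (RN_brackets _ _ axiomsN)// => [|y hy]; last first.
    by rewrite (RN_brackets _ _ axioms)// => z _; exact: courant_muE.
  rewrite (RN_brackets _ _ axioms)// => [|z _]; last exact: courant_muE.
  exact: deform_courant_twice.
- move=> x /hlistP hx.
  have [mK gK _] := one_form_sym gam lN2.
  rewrite (RN_1form _ _ _ _ mK gK)//; first last.
  + exact: one_form0.
  + by move=> d v; exact: one_form_homog.
  + exact: one_form_is1.
  (* Both operators are 1-forms, so their bracket lives in arity 1. *)
  have [x1|x1] := eqVneq (size x) 1%N; last first.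
    rewrite /ad (one_form_is1 _ _ x1) big1 ?sub0r => [|i _].
      by rewrite one_form0 ?oppr0.
    rewrite one_form_is1// size_cat /= size_takel ?(ltnW (ltn_ord i))// size_drop.
    by rewrite -addSnnS subnKC ?ltn_ord.
  case: x x1 {hx} => [|u [|//]] // _; rewrite /ad /= big_ord_recl big_ord0 /= addr0.
  by apply: pair_eq; rewrite /= ?subrr// mulrCA subrr.
Qed.
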